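(* Let $A,C\in\mathbb R^{m\times n}$ be non-zero matrices and $\beta\in\mathbb R^n$ a non-zero vector such that the polyhedra $P$ and $Q'$ are non-degenerate, and let $\mathcal P$ be the path component of $\mathcal N$. Then for every $\alpha\in\mathbb R^m$ the path $\mathcal P$ covers at least one Nash equilibrium of the game $G(\alpha)=(A,C+\alpha\beta^T)$; that is, there is a point $((y,\pi_1),(x,\lambda,\pi_2))\in\mathcal P$ with $\lambda=\sum_{i=1}^m\alpha_ix_i$, for which $(x,y)$ is a Nash equilibrium of $G(\alpha)$.
   Context: Let $S_1=\{1,\dots,m\}$, $S_2=\{1,\dots,n\}$, and let $\Delta_1\subset\mathbb R^m$, $\Delta_2\subset\mathbb R^n$ be the standard probability simplices. For a matrix $M$, $M_i$ is its $i$-th row and $M^j$ its $j$-th column. A Nash equilibrium of a bimatrix game $(A,B)$ is $(x,y)\in\Delta_1\times\Delta_2$ with $x^TAy\ge x'^TAy$ for all $x'\in\Delta_1$ and $x^TBy\ge x^TBy'$ for all $y'\in\Delta_2$. $P=\{(y,\pi_1)\in\mathbb R^{n+1}: A_iy-\pi_1\le0\ (i\in S_1);\ y_j\ge0\ (j\in S_2);\ \sum_j y_j=1\}$ (of dimension $n$). $Q'=\{(x,\lambda,\pi_2)\in\mathbb R^{m+2}: x_i\ge0\ (i\in S_1);\ x^TC^j+\beta_j\lambda-\pi_2\le0\ (j\in S_2);\ \sum_i x_i=1\}$ (of dimension $m+1$). In both polyhedra the inequalities indexed by $i\in S_1$ are numbered $1,\dots,m$ and those indexed by $j\in S_2$ are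 numbered $m+1,\dots,m+n$. The label $L(v)$ of a point is the set of numbers of inequalities tight at it. $\mathcal N=\{(v,w)\in P\times Q': L(v)\cup L(w)=\{1,\dots,m+n\}\}$. Non-degeneracy: every point in the relative interior of a $d$-dimensional face of $P$ (resp. $Q'$) has exactly $n-d$ (resp. $m+1-d$) tight inequalities. Non-degeneracy of $Q'$ is understood to entail that $\beta$ is not constant. In this setting $\mathcal N$ is a disjoint union of connected components lying on the $1$-skeleton of $P\times Q'$: exactly one path $\mathcal P$ (homeomorphic to $\mathbb R$, with an unbounded edge at each end) and finitely many (possibly zero) cycles (homeomorphic to a circle). *)

(* Defs.v *)
From mathcomp Require Import all_boot all_order all_algebra.
From mathcomp Require Import all_classical all_reals topology normedtype.

Set Implicit Arguments.
Unset Strict Implicit.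
Unset Printing Implicit Defensive.

Import Order.TTheory GRing.Theory Num.Theory.
Import numFieldNormedType.Exports.

Local Open Scope classical_set_scope.
Local Open Scope ring_scope.

(* Vectors of R^k are row vectors, so the x^T A y of a column-vector
   presentation is x *m A *m y^T here. *)

Section Games.
Variables (R : realType) (m n : nat).

Definition simplex (k : nat) : set 'rV[R]_k :=
  [set x | (forall i, 0 <= x 0 i) /\ \sum_i x 0 i = 1].

Definition payoff (M : 'M[R]_(m, n)) (x : 'rV[R]_m) (y : 'rV[R]_n) : R :=
  (x *m M *m y^T) 0 0.

Definition nash (A B : 'M[R]_(m, n)) (x : 'rV[R]_m) (y : 'rV[R]_n) : Prop :=
  [/\ simplex x, simplex y,
      forall x', simplex x' -> payoff A x' y <= payoff A x y
    & forall y', simplex y' -> payoff B x y' <= payoff B x y].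

End Games.

Section Polyhedra.
Variables (R : realType) (k l : nat).

Definition affine_hull (F : set 'rV[R]_k) : set 'rV[R]_k :=
  [set w | exists (r : nat) (p : 'I_r -> 'rV[R]_k) (c : 'I_r -> R),
     [/\ forall i, F (p i), \sum_i c i = 1 & w = \sum_i c i *: p i]].

(* The empty set has no dimension in this sense. *)
Definition has_dim (F : set 'rV[R]_k) (d : nat) : Prop :=
  exists (v : 'rV[R]_k) (U : {vspace 'rV[R]_k}),
    \dim U = d /\ affine_hull F = [set w | w - v \in U].

Definition relative_interior (F : set 'rV[R]_k) : set 'rV[R]_k :=
  [set v | F v /\ \forall w \near v, affine_hull F w -> F w].

(* Taking c = 0, the polyhedron itself (b = 0) and the empty set (b = 1) are
   faces; the latter has no points and plays no role below. *)
Definition face (S F : set 'rV[R]_k) : Prop :=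
  exists (c : 'rV[R]_k) (b : R),
    (forall v, S v -> \sum_i c 0 i * v 0 i <= b) /\
    F = [set v | S v /\ \sum_i c 0 i * v 0 i = b].

(* A family g encodes the numbered inequalities g q v <= 0. *)
Definition label (g : 'I_l -> 'rV[R]_k -> R) (v : 'rV[R]_k) : {set 'I_l} :=
  finset (fun q => g q v == 0).

(* D is the dimension of the polyhedron S, and the count is D - d, written
   additively because subtraction on nat is truncated. *)
Definition nondegenerate (S : set 'rV[R]_k) (g : 'I_l -> 'rV[R]_k -> R)
    (D : nat) : Prop :=
  forall (F : set 'rV[R]_k) (d : nat) (v : 'rV[R]_k),
    face S F -> has_dim F d -> relative_interior F v ->
    (#|label g v| + d)%N = D.

End Polyhedra.

Section BestResponsePolyhedra.
Variables (R : realType) (m n : nat).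

(* A point of R^(n+1) is (y, pi1); a point of R^(m+2) is (x, lambda, pi2). *)
Definition P_y (v : 'rV[R]_(n + 1)) : 'rV[R]_n := lsubmx v.
Definition P_pi1 (v : 'rV[R]_(n + 1)) : R := rsubmx v 0 0.
Definition Q_x (w : 'rV[R]_(m + 2)) : 'rV[R]_m := lsubmx w.
Definition Q_lambda (w : 'rV[R]_(m + 2)) : R := rsubmx w 0 ord0.
Definition Q_pi2 (w : 'rV[R]_(m + 2)) : R := rsubmx w 0 ord_max.

(* [fintype.split] sends the first m indices of 'I_(m + n) to rows and the remaining n
   to columns. *)
Definition P_ineq (A : 'M[R]_(m, n)) (q : 'I_(m + n)) (v : 'rV[R]_(n + 1)) : R :=
  match fintype.split q with
  | inl i => (A *m (P_y v)^T) i 0 - P_pi1 v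
  | inr j => - P_y v 0 j
  end.

Definition polyP (A : 'M[R]_(m, n)) : set 'rV[R]_(n + 1) :=
  [set v | (forall q, P_ineq A q v <= 0) /\ \sum_j P_y v 0 j = 1].

Definition Q_ineq (C : 'M[R]_(m, n)) (beta : 'rV[R]_n) (q : 'I_(m + n))
    (w : 'rV[R]_(m + 2)) : R :=
  match fintype.split q with
  | inl i => - Q_x w 0 i
  | inr j => (Q_x w *m C) 0 j + beta 0 j * Q_lambda w - Q_pi2 w
  end.

Definition polyQ (C : 'M[R]_(m, n)) (beta : 'rV[R]_n) : set 'rV[R]_(m + 2) :=
  [set w | (forall q, Q_ineq C beta q w <= 0) /\ \sum_i Q_x w 0 i = 1].

Definition nondegenerate_P (A : 'M[R]_(m, n)) : Prop :=
  nondegenerate (polyP A) (P_ineq A) n.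

(* For constant beta the face condition alone can hold, but then Q' contains a
   line; that case is excluded by convention. *)
Definition nondegenerate_Q (C : 'M[R]_(m, n)) (beta : 'rV[R]_n) : Prop :=
  nondegenerate (polyQ C beta) (Q_ineq C beta) m.+1 /\
  ~ (exists c : R, forall j, beta 0 j = c).

Definition setN (A C : 'M[R]_(m, n)) (beta : 'rV[R]_n) :
    set ('rV[R]_(n + 1) * 'rV[R]_(m + 2)) :=
  [set vw | [/\ polyP A vw.1, polyQ C beta vw.2
    & (label (P_ineq A) vw.1 :|: label (Q_ineq C beta) vw.2)%SET = finset.setT]].

End BestResponsePolyhedra.

Section Paths.
Variables (R : realType) (T : topologicalType).

Definition homeomorphic (S : topologicalType) (X : set S) (Y : set T) : Prop :=
  exists (f : S -> T) (g : T -> S),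
    [/\ f @` X = Y, {in X, cancel f g},
        {within X, continuous f} & {within Y, continuous g}].

Definition is_component (N K : set T) : Prop :=
  exists2 z, N z & K = connected_component N z.

Definition is_path (N K : set T) : Prop :=
  is_component N K /\ homeomorphic [set: R] K.

(* The definite article carries uniqueness: when several entries of beta attain
   the maximum (or minimum), N can have more than one component homeomorphic to
   the real line. *)
Definition is_the_path (N K : set T) : Prop :=
  is_path N K /\ forall K', is_path N K' -> K' = K.

End Paths.

(* Main.v *)
(* N is the set of complementary points of a polyhedron: the constraints are
   grouped into slots, and a point is complementary when every slot contains a
   tight constraint.  Non-degeneracy says that the gradients of the tight
   constraints are linearly independent, so the stratum of a choice of one tight
   constraint per slot is a segment or a ray, and each vertex lies on exactly two
   strata.  Following the strata from a ray therefore never revisits a point and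
   ends on another ray, and the union of the visited strata is a closed and
   relatively open copy of the real line, hence a component.

   On the slice s * lambda = c (s = 1 or -1, c large) a label k is dropped, as in
   the Lemke-Howson algorithm; the slice path is glued to the part of N beyond
   the slice.  This complementary set has an explicit ray over a pair of pure
   strategies, and non-degeneracy makes it the only ray with bounded lambda, so
   the other end is a ray of N on which s * lambda tends to infinity.  The
   component of N containing it is homeomorphic to the line, so it is the path.
   Thus lambda takes arbitrarily large values of both signs on the path, while
   alpha . x stays bounded, and connectedness gives lambda = alpha . x. *)

Require Import Defs.
From HB Require Import structures.
From mathcomp Require Import all_boot all_order all_algebra.
From mathcomp Require Import all_classical all_reals topology normedtype.
From mathcomp Require Import ring lra zify.

Set Implicit Arguments.
Unset Strict Implicit.
Unset Printing Implicit Defensive.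

Import Order.TTheory GRing.Theory Num.Theory.
Import numFieldNormedType.Exports.

Local Open Scope classical_set_scope.
Local Open Scope ring_scope.

(** * Gluing homeomorphisms *)

Definition homeo_on (S T : topologicalType) (A : set S) (B : set T)
    (f : S -> T) (g : T -> S) : Prop :=
  [/\ f @` A = B, {in A, cancel f g},
      {within A, continuous f} & {within B, continuous g}].

Lemma within_continuous_glue (S T : topologicalType) (A1 A2 : set S)
    (f1 f2 : S -> T) :
  closed A1 -> closed A2 ->
  {within A1, continuous f1} -> {within A2, continuous f2} ->
  (forall x, A1 x -> A2 x -> f1 x = f2 x) ->
  {within A1 `|` A2, continuous (fun x => if x \in A1 then f1 x else f2 x)}.
Proof.
move=> cA1 cA2 c1 c2 e12; apply: withinU_continuous => //.
  by apply: (@subspace_eq_continuous _ A1 _ f1) => // x Ax; rewrite /from_subspace Ax.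
apply: (@subspace_eq_continuous _ A2 _ f2) => // x /set_mem Ax; rewrite /from_subspace.
by case: ifPn => // /set_mem A1x; rewrite e12.
Qed.

(** The last clause keeps the values on [A2], which is how the end point of a lengthened walk is
    located. *)
Lemma homeo_on_glue (S T : topologicalType) (A1 A2 : set S) (B1 B2 : set T)
    f1 f2 g1 g2 :
  closed A1 -> closed A2 -> closed B1 -> closed B2 ->
  homeo_on A1 B1 f1 g1 -> homeo_on A2 B2 f2 g2 ->
  (forall x, A1 x -> A2 x -> f1 x = f2 x) ->
  (forall y, B1 y -> B2 y -> g1 y = g2 y) ->
  exists f g, homeo_on (A1 `|` A2) (B1 `|` B2) f g /\
    forall x, A2 x -> f x = f2 x.
Proof.
move=> cA1 cA2 cB1 cB2 [im1 K1 cf1 cg1] [im2 K2 cf2 cg2] ef eg.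
exists (fun x => if x \in A1 then f1 x else f2 x).
exists (fun y => if y \in B1 then g1 y else g2 y).
have fA2 x : A2 x -> (if x \in A1 then f1 x else f2 x) = f2 x.
  by move=> Ax; case: ifPn => // /set_mem A1x; rewrite ef.
split=> //; split.
- rewrite image_setU; congr (_ `|` _).
    rewrite -im1; apply: eq_imagel => x Ax; by rewrite (mem_set Ax).
  by rewrite -im2; apply: eq_imagel => x Ax; rewrite fA2.
- move=> x; rewrite inE => -[Ax|Ax].
    have B1x : B1 (f1 x) by rewrite -im1; exists x.
    by rewrite (mem_set Ax) (mem_set B1x) K1 ?inE.
  rewrite fA2 //; have B2x : B2 (f2 x) by rewrite -im2; exists x.
  case: ifPn => [/set_mem B1x|_]; last by rewrite K2 ?inE.
  by rewrite eg // K2 ?inE.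
- exact: within_continuous_glue.
- exact: within_continuous_glue.
Qed.

(** [K] is relatively closed in the component of [z], and relatively open in it because the rest of
    [N] is cut out by a closed set. A connected set has no other non-empty subset of this kind than
    itself. *)
Lemma clopen_connected_component (T : topologicalType) (N K : set T) (z : T) :
  K z -> K `<=` N -> connected K -> closed K ->
  (exists2 C, closed C & N `\` K = N `&` C) ->
  K = connected_component N z.
Proof.
move=> Kz KN cK clK [C clC NK]; apply/seteqP; split.
  exact: connected_component_max.
have NKC x : N x -> K x <-> ~ C x.
  move=> Nx; split=> [Kx Cx|nCx].
    have : (N `\` K) x by rewrite NK; split.
    by case.
  apply: contrapT => nKx; have : (N `\` K) x by [].
  by rewrite NK => -[].
pose D := connected_component N z.
have DN : D `<=` N by exact: connected_component_sub.
have Dz : D z by apply: connected_component_refl; apply: KN.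
suff e : D `&` K = D by rewrite -/D -e => x [].
apply: (@component_connected _ N z).
- by exists z.
- exists (~` C); first exact: closed_openC.
  by apply/seteqP; split=> x [Dx]; rewrite /setC /= => h; split=> //;
    apply/(NKC x (DN _ Dx)).
- by exists K.
Qed.

(** * Following complementary strata *)

Section Complementarity.
Variables (R : realType) (V : normedModType R) (T U : finType) (pi : T -> U).
Variables (a : T -> V -> R) (b : T -> R).

Definition slack q z := a q z + b q.

Definition selection (s : {ffun U -> T}) : Prop := forall u, pi (s u) = u.

Definition stratum (s : {ffun U -> T}) : set V :=
  [set z | (forall q, slack q z <= 0) /\ forall u, slack (s u) z = 0].

Definition complementary : set V :=
  [set z | exists2 s, selection s & stratum s z].

Hypothesis a_scalar : forall q, scalar (a q).
Hypothesis a_cont : forall q, continuous (a q).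
Hypothesis a_pointed : forall d, (forall q, a q d = 0) -> d = 0.
(** Independence of the tight gradients, phrased as the freedom to prescribe their values on some
    direction, because [V] is not assumed finite-dimensional. For the same reason [a_line] stands in
    for a dimension count. *)
Hypothesis a_indep : forall z, complementary z -> forall tau : T -> R,
  exists d, forall q, slack q z = 0 -> a q d = tau q.
Hypothesis a_line : forall s z, selection s -> stratum s z ->
  exists e, [/\ e != 0, forall u, a (s u) e = 0
    & forall d, (forall u, a (s u) d = 0) -> exists c, d = c *: e].

Lemma aDZ q z t d : a q (z + t *: d) = a q z + t * a q d.
Proof. by rewrite addrC a_scalar addrC. Qed.

Lemma a0 q : a q 0 = 0.
Proof.
have := aDZ q 0 1 0; rewrite scaler0 addr0 mul1r => h.
by apply: (@addrI _ (a q 0)); rewrite -h addr0.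
Qed.

Lemma aZ q t d : a q (t *: d) = t * a q d.
Proof. by rewrite -[t *: d]add0r aDZ a0 add0r. Qed.

Lemma aB q z z' : a q (z - z') = a q z - a q z'.
Proof. by rewrite -scaleN1r aDZ mulN1r. Qed.

Lemma slackDZ q z t d : slack q (z + t *: d) = slack q z + t * a q d.
Proof. by rewrite /slack aDZ addrAC. Qed.

Lemma slackB q z z' : a q (z' - z) = slack q z' - slack q z.
Proof. by rewrite /slack aB opprD addrACA subrr addr0. Qed.

(** Prescribing 1 on one tight constraint outside the selection and 0 on the other tight ones yields
    a multiple of [e]. So that constraint varies along [e] while every other tight one is constant,
    which leaves room for only one of the kind. *)
Lemma edge_direction s z : selection s -> stratum s z ->
  exists e, [/\ e != 0, forall u, a (s u) e = 0,
    forall d, (forall u, a (s u) d = 0) -> exists c, d = c *: e,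
    forall p, slack p z = 0 -> p != s (pi p) -> a p e != 0
    & forall p p', slack p z = 0 -> p != s (pi p) ->
      slack p' z = 0 -> p' != s (pi p') -> p = p'].
Proof.
move=> ts sz; have [e [e0 ae eP]] := a_line ts sz.
have Nz : complementary z by exists s.
have dir p : slack p z = 0 -> p != s (pi p) ->
    exists c, [/\ c != 0, c * a p e = 1
      & forall p', slack p' z = 0 -> p' != p -> a p' e = 0].
  move=> pz ps; have [d dP] := a_indep Nz (fun q => (q == p)%:R).
  have [u|c dc] := eP d.
    rewrite dP; last by case: sz => _ ->.
    by case: eqP => // su; move: ps; rewrite -su ts eqxx.
  have c1 : c * a p e = 1 by rewrite -aZ -dc dP // eqxx.
  have c0 : c != 0 by apply: contra_eq_neq c1 => ->; rewrite mul0r eq_sym oner_neq0.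
  exists c; split=> // p' p'z /negPf pp'; apply: (mulfI c0).
  by rewrite -aZ -dc dP // pp' mulr0.
exists e; split=> // [p pz ps|p p' pz ps p'z ps'].
  have [c [_ c1 _]] := dir p pz ps.
  by apply: contra_eq_neq c1 => ->; rewrite mulr0 eq_sym oner_neq0.
apply/eqP; apply: contraT => pp'.
have [c [_ c1 _]] := dir p pz ps; have [_ [_ _ h]] := dir p' p'z ps'.
by have /eqP := c1; rewrite h // mulr0 eq_sym oner_eq0.
Qed.

Lemma tight_outside s s' z : selection s' -> s' != s -> stratum s' z ->
  exists2 p, slack p z = 0 & p != s (pi p).
Proof.
move=> ts' ss' [_ s'z].
have [u su] : exists u, s' u != s u.
  apply/existsP; apply: contraT; rewrite negb_exists => /forallP h.
  by move: ss'; rewrite (_ : s' = s) ?eqxx //; apply/ffunP => u; apply/eqP/negPn.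
by exists (s' u) => //; rewrite ts'.
Qed.

Lemma stratum_line s z z' d : selection s -> stratum s z -> stratum s z' ->
  d != 0 -> (forall u, a (s u) d = 0) -> exists c, z' = z + c *: d.
Proof.
move=> ts sz sz' d0 ad; have [e [e0 ae eP]] := a_line ts sz.
have [|c1 h1] := eP (z' - z).
  by move=> u; rewrite slackB; case: sz => _ ->; case: sz' => _ ->; rewrite subrr.
have [c2 h2] := eP d ad.
have c20 : c2 != 0 by apply: contra_neq d0 => c20; rewrite h2 c20 scale0r.
exists (c1 / c2); rewrite h2 scalerA divfK // -h1; by rewrite addrC subrK.
Qed.

(** Only one constraint outside [s1] is tight at [z], so a second selection through [z] must differ
    from [s1] by exchanging in exactly that constraint. Hence walks never branch. *)
Lemma three_strata s1 s2 s3 z : selection s1 -> selection s2 ->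
  selection s3 -> stratum s1 z -> stratum s2 z -> stratum s3 z ->
  s2 != s1 -> s3 != s1 -> s2 = s3.
Proof.
move=> t1 t2 t3 z1 z2 z3 n2 n3; have [e [_ _ _ _ up]] := edge_direction t1 z1.
have same s s' u : selection s -> selection s' -> stratum s z ->
    stratum s' z -> s' != s1 -> s u != s1 u -> s u = s' u.
  move=> ts ts' sz sz' ns su.
  have [p pz ps] := tight_outside ts' ns sz'.
  have ep : s u = p by apply: up => //; rewrite ?ts //; case: sz => _ ->.
  have [e1|] := eqVneq (s' u) (s1 u).
    have [v sv] : exists v, s' v != s1 v.
      apply/existsP; apply: contraT; rewrite negb_exists => /forallP h.
      move: ns; rewrite (_ : s' = s1) ?eqxx //; apply/ffunP => v.
      by apply/eqP/negPn.
    have ev : s' v = p by apply: up => //; rewrite ?ts' //; case: sz' => _ ->.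
    by have := ts u; rewrite ep -ev ts' => uv; move: sv; rewrite uv e1 eqxx.
  by move=> sv; apply: up; rewrite ?ts ?ts' //; move: sz sz' => [_ zs] [_ zs'];
    rewrite ?zs ?zs'.
apply/ffunP => u; have [e2|] := eqVneq (s2 u) (s1 u); last exact: same.
have [e3|h] := eqVneq (s3 u) (s1 u); first by rewrite e2 e3.
by apply/esym; apply: same.
Qed.

Lemma pivot s z p : selection s -> stratum s z -> slack p z = 0 ->
  p != s (pi p) -> exists s', [/\ selection s', stratum s' z & s' != s].
Proof.
move=> ts [zle zs] pz ps.
exists [ffun u => if u == pi p then p else s u]; split.
- by move=> u; rewrite ffunE; case: eqP => [->|].
- by split=> // u; rewrite ffunE; case: ifP.
- by apply: contra_neq ps => <-; rewrite ffunE eqxx.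
Qed.

(** The ratio test of the simplex method: the step length is the least ratio [- slack q z / a q d]
    over the constraints growing along [d]. It is positive because no constraint tight at [z]
    grows. *)
Lemma advance s z d : stratum s z -> (forall u, a (s u) d = 0) ->
  (forall q, slack q z = 0 -> a q d <= 0) ->
  (forall t, 0 <= t -> stratum s (z + t *: d)) \/
  exists t q, [/\ 0 < t, stratum s (z + t *: d), slack q (z + t *: d) = 0
    & 0 < a q d].
Proof.
move=> [zle zs] ad feas.
have [/existsP[q0 q0d]|] := boolP [exists q, 0 < a q d]; last first.
  rewrite negb_exists => /forallP h; left => t t0; split=> [q|u].
    rewrite slackDZ -[leRHS]addr0 lerD // mulr_ge0_le0 //.
    by rewrite leNgt; apply: h.
  by rewrite slackDZ zs ad mulr0 addr0.
right.
case: (@arg_minP _ R T q0 (fun q => 0 < a q d)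
  (fun q => - slack q z / a q d) q0d) => q qd qmin.
have sq : slack q z != 0.
  by apply/negP => /eqP /feas; rewrite leNgt qd.
exists (- slack q z / a q d), q; split=> //.
- by rewrite divr_gt0 // oppr_gt0 lt_neqAle sq zle.
- split=> [r|u]; last by rewrite slackDZ zs ad mulr0 addr0.
  rewrite slackDZ; have [rd|rd] := ltP 0 (a r d).
    by have := qmin r rd; rewrite ler_pdivlMr //; lra.
  rewrite -[leRHS]addr0 lerD // mulr_ge0_le0 // ltW //.
  by rewrite divr_gt0 // oppr_gt0 lt_neqAle sq zle.
- by rewrite slackDZ divfK ?gt_eqF // subrr.
Qed.

(** * Strata as closed rays and segments *)

Lemma slack_cont q : continuous (slack q).
Proof. by move=> z; apply: cvgD; [exact: a_cont|exact: cvg_cst]. Qed.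

Lemma closed_stratum s : closed (stratum s).
Proof.
have -> : stratum s = \bigcap_(q in setT) (slack q @^-1` [set t | t <= 0]) `&`
    \bigcap_(u in setT) (slack (s u) @^-1` [set 0]).
  apply/seteqP; split=> z [h1 h2]; split=> q; first by move=> _; apply: h1.
  - by move=> _; apply: h2.
  - exact: (h1 q).
  - exact: (h2 q).
apply: closedI; apply: closed_bigI => q _.
  by apply: preimage_closed; [move=> ? _; exact: slack_cont|exact: closed_le].
by apply: preimage_closed; [move=> ? _; exact: slack_cont|exact: closed_eq].
Qed.

Definition edge_points (J : set R) z d : set V := [set z + t *: d | t in J].

(** The extra tight constraint [p] makes [z] an end of the stratum, and [advance] decides whether
    there is another end. A point shared with another stratum has a tight constraint that varies
    along [d], so it can only be an end. *)
Lemma edge_structure s z p : selection s -> stratum s z -> slack p z = 0 ->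
  p != s (pi p) ->
  exists d J, [/\ a p d < 0, (forall u, a (s u) d = 0),
    stratum s = edge_points J z d
    & J = [set t | 0 <= t] /\ (forall s' z', selection s' -> s' != s ->
        stratum s z' -> stratum s' z' -> z' = z) \/
    exists t, [/\ 0 < t, J = [set x | 0 <= x <= t],
      (forall s' z', selection s' -> s' != s ->
        stratum s z' -> stratum s' z' -> z' = z \/ z' = z + t *: d)
      & exists s', [/\ selection s', s' != s & stratum s' (z + t *: d)]]].
Proof.
move=> ts sz pz ps; have [e [e0 ae eP ape up]] := edge_direction ts sz.
(* The kernel direction is oriented so that [p] becomes slack on leaving [z]. *)
have [d [d0 ad apd]] : exists d, [/\ d != 0, (forall u, a (s u) d = 0) & a p d < 0].
  exists (- Num.sg (a p e) *: e); have spe := ape p pz ps; split.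
  - by rewrite scaler_eq0 oppr_eq0 sgr_eq0 negb_or spe.
  - by move=> u; rewrite aZ ae mulr0.
  - by rewrite aZ mulNr -normrEsg oppr_lt0 normr_gt0.
have feas q : slack q z = 0 -> a q d <= 0.
  move=> qz; have [->|qs] := eqVneq q (s (pi q)); first by rewrite ad.
  by rewrite (up q p) // ltW.
have pos z' : stratum s z' -> exists2 c, 0 <= c & z' = z + c *: d.
  move=> sz'; have [c zc] := stratum_line ts sz sz' d0 ad.
  exists c => //; have : slack p z' <= 0 by case: sz'.
  by rewrite zc slackDZ pz add0r nmulr_lle0.
have vtx c s' : selection s' -> s' != s -> stratum s (z + c *: d) ->
    stratum s' (z + c *: d) -> exists2 q, slack q (z + c *: d) = 0 & a q d != 0.
  move=> ts' ss' sc sc'; have [q qz qs] := tight_outside ts' ss' sc'.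
  exists q => //; have [e' [_ _ eP' ape' _]] := edge_direction ts sc.
  have [c' dc] := eP' d ad.
  rewrite dc aZ mulf_neq0 ?ape' //; apply: contra_neq d0 => c0.
  by rewrite dc c0 scale0r.
exists d.
have [ray|[t [q [t0 st qt aq]]]] := advance sz ad feas.
  exists [set t | 0 <= t]; split=> //=.
    apply/seteqP; split=> [z' /pos[c c0 ->]|_ [c c0 <-]]; first by exists c.
    exact: ray.
  left; split=> // s' z' ts' ss' sz' sz''.
  have [c c0 zc] := pos z' sz'; rewrite zc in sz' sz'' *.
  have [q qz aq] := vtx c s' ts' ss' sz' sz''.
  (* A constraint tight at parameter [c] and feasible at [c + 1] must decrease along [d];
     feasibility at 0 then gives [c <= 0]. *)
  have [/(_ q)] := ray (c + 1) (addr_ge0 c0 ler01).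
  have := sz => -[/(_ q)].
  move: qz; rewrite !slackDZ => qz qz0 _ qz1 _.
  have aq0 : a q d < 0 by rewrite lt_neqAle aq /=; lra.
  have cle : c <= 0 by rewrite -(nmulr_lge0 _ aq0); lra.
  by rewrite (@le_anti _ _ c 0) ?c0 ?cle // scale0r addr0.
have upto z' : stratum s z' -> exists2 c, 0 <= c <= t & z' = z + c *: d.
  move=> sz'; have [c c0 zc] := pos z' sz'; exists c => //; rewrite c0 /=.
  have [/(_ q)] := sz'; move: qt; rewrite zc !slackDZ => qt qc _.
  by rewrite -subr_le0 -(pmulr_lle0 _ aq); lra.
exists [set x | 0 <= x <= t]; split=> //=; last 1 first.
- right; exists t; split=> //; last first.
    have qs : q != s (pi q) by apply: contraTneq aq => ->; rewrite ad ltxx.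
    by have [s' [ts' s't ss']] := pivot ts st qt qs; exists s'.
  move=> s' z' ts' ss' sz' sz''.
  have [c /andP[c0 ct] zc] := upto z' sz'; rewrite zc in sz' sz'' *.
  have [r rz ar] := vtx c s' ts' ss' sz' sz''.
  (* Since [r] is tight at [c] and feasible at 0 and at [t], the sign of its slope places [c] at one
     of these two ends. *)
  have [/(_ r) h1 _] := st; have [/(_ r) h2 _] := sz.
  move: rz h1; rewrite !slackDZ => rz h1.
  have {}ar : a r d < 0 \/ 0 < a r d by apply/orP; rewrite -neq_lt.
  case: ar => ar; [left|right].
    suff cle : c <= 0 by rewrite (@le_anti _ _ c 0) ?c0 ?cle // scale0r addr0.
    by rewrite -(nmulr_lge0 _ ar); lra.
  suff cle : t <= c by rewrite (@le_anti _ _ c t) ?ct ?cle.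
  by rewrite -subr_le0 -(pmulr_lle0 _ ar); lra.
- apply/seteqP; split=> [z' /upto[c c0 ->]|_ [c c0 <-]]; first by exists c.
  have /andP[c0' ct] := c0; split=> [r|u]; last first.
    by rewrite slackDZ ad; case: sz => _ ->; rewrite mulr0 addr0.
  have [/(_ r) h1 _] := st; have [/(_ r) h2 _] := sz.
  move: h1; rewrite !slackDZ => h1.
  by have [ar|ar] := leP 0 (a r d); nra.
Qed.

(** * Walks through consecutive strata *)

Lemma closed_edge_params (J : set R) alpha :
  closed J -> closed [set t | J (t - alpha)].
Proof.
move=> cJ; apply: (@preimage_closed _ _ (fun t => t - alpha)) => // t _.
by apply: cvgB; [exact: cvg_id|exact: cvg_cst].
Qed.

(** The constraint [p] serves as a coordinate: since it varies along [d], the parameter is an affine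
    function of [a p]. *)
Lemma edge_homeo (J : set R) z d p alpha : a p d != 0 ->
  homeo_on [set t | J (t - alpha)] (edge_points J z d)
    (fun t => z + (t - alpha) *: d)
    (fun x => alpha + (a p x - a p z) / a p d).
Proof.
move=> apd; split.
- apply/seteqP; split=> [_ [t Jt <-]|_ [t Jt <-]]; first by exists (t - alpha).
  by exists (alpha + t); rewrite /= addrAC subrr add0r.
- by move=> t _; rewrite aDZ addrAC subrr add0r mulfK // addrC subrK.
- apply: continuous_subspaceT => t; apply: cvgD; first exact: cvg_cst.
  by apply: cvgZ; [apply: cvgB; [exact: cvg_id|exact: cvg_cst]|exact: cvg_cst].
- apply: continuous_subspaceT => x; apply: cvgD; first exact: cvg_cst.
  apply: cvgM; last exact: cvg_cst.
  by apply: cvgB; [exact: a_cont|exact: cvg_cst].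
Qed.

Definition union_of (s : {set {ffun U -> T}}) : set V :=
  [set z | exists2 t, t \in s & stratum t z].

Lemma closed_union_of s : closed (union_of s).
Proof.
rewrite (_ : union_of s = \bigcup_(t in [set` s]) stratum t).
  apply: closed_bigcup => [|t _]; last exact: closed_stratum.
  exact: finite_finset.
by apply/seteqP; split=> z [t ts tz]; exists t.
Qed.

Lemma union_ofU1 t s : union_of (t |: s)%SET = union_of s `|` stratum t.
Proof.
apply/seteqP; split=> z.
  by case=> r; rewrite !inE => /predU1P[->|rs] rz; [right|left; exists r].
case=> [[r rs rz]|tz]; first by exists r; rewrite // !inE rs orbT.
by exists t; rewrite // !inE eqxx.
Qed.

(** A walk in progress, with one end open and the other at [z]. The last clause is the invariant
    under which the next stratum can be glued on injectively. *)
Definition half_walk (s : {set {ffun U -> T}}) z : Prop :=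
  [/\ forall t, t \in s -> selection t,
    exists f g alpha,
      homeo_on [set t : R | t <= alpha] (union_of s) f g /\ f alpha = z
    & forall t z', selection t -> t \notin s -> stratum t z' ->
        union_of s z' -> z' = z].

Definition full_walk (s : {set {ffun U -> T}}) f g : Prop :=
  [/\ forall t, t \in s -> selection t,
    homeo_on [set: R] (union_of s) f g
    & forall t z', selection t -> t \notin s -> stratum t z' ->
        ~ union_of s z'].

(** Induction on the number of unvisited strata. The stratum [t] is glued on at [z]: a ray completes
    the walk, and a segment has a far end on a further stratum. By [three_strata] no unvisited
    stratum remains at [z], so the invariant passes to the far end. *)
Lemma half_walk_ends s z t : half_walk s z -> selection t -> t \notin s ->
  stratum t z -> exists (s' : {set {ffun U -> T}}) f g, [/\ s \subset s', full_walk s' f g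
    & exists t1 z1 d1, [/\ selection t1, t1 \notin s, d1 != 0
      & forall x, 0 <= x -> stratum t1 (z1 + x *: d1)]].
Proof.
move: {2}(#|~: s|)%SET (leqnn #|~: s|)%SET => n.
elim: n s z t => [|n IH] s z t sn [tr [f [g [alpha [hom fz]]]] out] tt ts tz.
  by move: sn; rewrite leqn0 cards_eq0 => /eqP/setP/(_ t); rewrite !inE ts.
have [imf fK cf cg] := hom.
have sz : union_of s z by rewrite -imf -fz; exists alpha => /=.
have [r rs rz] := sz.
have rt : r != t by apply: contraNneq ts => <-.
have [p pz pt] := tight_outside (tr _ rs) rt rz.
have [d [J [apd ad SJ JP]]] := edge_structure tt tz pz pt.
have apd0 : a p d != 0 by rewrite lt_eqF.
have d0 : d != 0 by apply: contraTneq apd => ->; rewrite a0 ltxx.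
have Jge x : J x -> 0 <= x.
  by case: JP => [[-> _]//|[t0 [_ -> _ _]] /andP[]].
have cJ : closed J.
  case: JP => [[-> _]|[t0 [_ -> _ _]]]; first exact: closed_ge.
  have -> : [set x | 0 <= x <= t0] = [set x | 0 <= x] `&` [set x | x <= t0].
    by apply/seteqP; split=> x /andP.
  by apply: closedI; [exact: closed_ge|exact: closed_le].
have hom2 := edge_homeo J z alpha apd0; rewrite -SJ in hom2.
have [||x /= xa Jx|y sy ty|f' [g' [hom' ef']]] :=
  homeo_on_glue _ (closed_edge_params cJ) _ (@closed_stratum t) hom hom2.
- exact: closed_le.
- exact: closed_union_of.
- have /le_anti -> : x <= alpha <= x by rewrite xa -subr_ge0 Jge.
  by rewrite subrr scale0r addr0.
- rewrite (out _ _ tt ts ty sy) subrr mul0r addr0 -fz fK //.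
  by rewrite inE /=.
rewrite -union_ofU1 in hom'.
have tr' t' : t' \in (t |: s)%SET -> selection t'.
  by rewrite !inE => /predU1P[->//|/tr].
have noz t' : selection t' -> t' \notin (t |: s)%SET -> ~ stratum t' z.
  rewrite !inE => tt'; rewrite negb_or => /andP[t't t's] t'z.
  by move: t's; rewrite (three_strata tt tt' (tr _ rs) tz t'z rz) ?rs.
have sub : s \subset (t |: s)%SET by rewrite finset.subsetUr.
case: JP => [[JE iso]|[t0 [t0p JE iso [r' [tr'' r't r't0]]]]].
  exists (t |: s)%SET, f', g'; split=> //.
    split=> // [|t' z' tt' t's' sz']; last first.
      rewrite union_ofU1 => zz'; apply: (noz t' tt' t's'); move: (t's').
      rewrite !inE negb_or => /andP[t't t's].
      suff <- : z' = z by [].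
      case: zz' => zz'; first exact: (out t').
      by apply: (iso t').
    rewrite (_ : [set: R] = [set x | x <= alpha] `|` [set x | J (x - alpha)]) //.
    apply/seteqP; split=> // x _ /=; rewrite JE /= subr_ge0.
    by apply/orP; exact: le_total.
  exists t, z, d; split=> // x x0.
  by rewrite SJ; exists x; rewrite // JE.
set z1 := z + t0 *: d in r't0 iso.
have tz1 : stratum t z1 by rewrite SJ; exists t0; rewrite // JE /= lexx ltW.
have z1z : z1 <> z.
  move=> /(congr1 (a p)); rewrite /z1 aDZ => e.
  have : t0 * a p d < 0 by rewrite pmulr_rlt0.
  by lra.
(* The visited strata meet [t] only at [z], so the walk cannot close up into a cycle. *)
have r's : r' \notin s.
  by apply/negP => r's; apply: z1z; apply: (out t) => //; exists r'.
have [||||s' [f1 [g1 [ss' full [t1 [z2 [d1 [h1 h2 h3 h4]]]]]]]] :=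
    IH (t |: s)%SET z1 r' _ _ tr''.
- rewrite -ltnS; apply: leq_trans sn; apply: proper_card.
  by rewrite properC properUr // finset.sub1set.
- split=> //; first exists f', g', (alpha + t0); last first.
    move=> t' z' tt' t's' sz'; rewrite union_ofU1 => zz'; move: (t's').
    rewrite !inE negb_or => /andP[t't t's].
    have zN : z' <> z by move=> e; apply: (noz t' tt' t's'); rewrite -e.
    case: zz' => zz'; first by case: zN; exact: (out t').
    by case: (iso t' z').
  rewrite (_ : [set t1 | _] = [set x | x <= alpha] `|` [set x | J (x - alpha)]).
    split=> //; rewrite ef' /= ?JE /= addrAC subrr add0r //.
    by rewrite lexx ltW.
  apply/seteqP; split=> x /=; rewrite JE /= subr_ge0 lerBlDl.
    by have [|/ltW] := leP x alpha; [left|move=> ? ?; right; apply/andP].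
  by case=> [xa|/andP[]//]; apply: le_trans xa _; rewrite lerDl ltW.
- by rewrite !inE negb_or r't.
- by [].
exists s', f1, g1; split=> //; first exact: fintype.subset_trans ss'.
exists t1, z2, d1; split=> //.
by apply: contraNN h2 => ?; rewrite !inE; apply/orP; right.
Qed.

(** * Rays and the components containing them *)

Lemma recession s z d : (forall x, 0 <= x -> stratum s (z + x *: d)) ->
  (forall u, a (s u) d = 0) /\ forall q, a q d <= 0.
Proof.
move=> ray; split=> [u|q].
  have [_ /(_ u)] := ray 0 (lexx 0); have [_ /(_ u)] := ray 1 ler01.
  by rewrite !slackDZ; lra.
rewrite leNgt; apply/negP => aq.
have p0 : 0 <= `|slack q z| / a q d + 1 by rewrite addr_ge0 // divr_ge0 // ltW.
have [/(_ q)] := ray _ p0; rewrite slackDZ mulrDl divfK ?gt_eqF // mul1r => h _.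
by have := ler_norm (- slack q z); rewrite normrN; lra.
Qed.

Theorem ray_component s0 z0 d0 : selection s0 -> d0 != 0 ->
    (forall x, 0 <= x -> stratum s0 (z0 + x *: d0)) ->
  exists K f g, [/\ homeo_on [set: R] K f g,
    K = connected_component complementary z0,
    forall x, 0 <= x -> K (z0 + x *: d0)
    & exists s1 z1 d1, [/\ selection s1, s1 != s0, d1 != 0
      & forall x, 0 <= x -> stratum s1 (z1 + x *: d1)]].
Proof.
(* Starting one unit inside the ray makes [- d0] a feasible direction, so the ray can be followed
   backwards to its vertex. *)
move=> ts d0n ray; pose y := z0 + 1 *: d0.
have sy : stratum s0 y by apply: ray.
have yE x : 0 <= x + 1 -> stratum s0 (y + x *: d0).
  by move=> x1; rewrite -addrA -scalerDl (addrC 1); apply: ray.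
have [ad dle] := recession ray.
(* Pointedness supplies a constraint that strictly decreases along the ray, and hence stops the
   backward motion. *)
have dq : exists q, a q d0 < 0.
  apply: contrapT => h; move/negP: d0n; apply; apply/eqP/a_pointed => q.
  apply/le_anti; rewrite dle /= leNgt; apply/negP => aq.
  by apply: h; exists q.
have tight q : slack q y = 0 -> a q (- 1 *: d0) <= 0.
  rewrite aZ mulN1r => qy; rewrite oppr_le0.
  have p0 : 0 <= - 1 + 1 :> R by rewrite addNr.
  have [/(_ q)] := yE _ p0.
  by rewrite slackDZ qy; lra.
have adN u : a (s0 u) (- 1 *: d0) = 0 by rewrite aZ ad mulr0.
have [line|[t [q [t0 st qt aq]]]] := advance sy adN tight.
  have [q aq] := dq.
  have p0 : 0 <= `|slack q y| / - a q d0 + 1.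
    by rewrite addr_ge0 // divr_ge0 // oppr_ge0 ltW.
  have [/(_ q)] := line _ p0.
  rewrite slackDZ aZ mulN1r mulrDl divfK ?oppr_eq0 ?lt_eqF // mul1r => h _.
  by have := ler_norm (- slack q y); rewrite normrN; lra.
have qs : q != s0 (pi q) by apply: contraTneq aq => ->; rewrite adN ltxx.
have {}aq : a q d0 < 0 by move: aq; rewrite aZ mulN1r oppr_gt0.
set z1 := y + _ in st qt.
have [d [J [apd ad' SJ JP]]] := edge_structure ts st qt qs.
have dn : d != 0 by apply: contraTneq apd => ->; rewrite a0 ltxx.
(* The stratum contains a ray, so it is not a segment: the point of the ray at [x / c] beyond [y]
   would have parameter larger than [x]. *)
have {JP}[JE iso] : J = [set t | 0 <= t] /\
    (forall s' z', selection s' -> s' != s0 ->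
        stratum s0 z' -> stratum s' z' -> z' = z1).
  case: JP => // -[x [x0 JE _ _]]; exfalso.
  have [c dc] := stratum_line ts sy (yE 1 (addr_ge0 ler01 ler01)) dn ad'.
  have {}dc : d0 = c *: d by apply: (addrI y); rewrite -dc scale1r.
  have c0 : 0 < c by move: aq; rewrite dc aZ nmulr_llt0.
  have : stratum s0 (y + (x / c) *: d0).
    by apply: yE; rewrite addr_ge0 // divr_ge0 // ltW.
  rewrite SJ => -[x' Jx'] /(congr1 (a q)).
  rewrite /z1 dc !aDZ !aZ; move: Jx'; rewrite JE => /andP[_ x'x] e.
  have e2 : (x' - t * c - x) * a q d = 0.
    have e3 : x / c * (c * a q d) = x * a q d by rewrite mulrA divfK ?gt_eqF.
    by move: e; rewrite e3; lra.
  have aqd : a q d != 0 by apply: contraTneq aq => aqd; rewrite dc aZ aqd mulr0 ltxx.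
  move/eqP: e2; rewrite mulf_eq0 (negPf aqd) orbF => /eqP.
  by have := mulr_gt0 t0 c0; lra.
(* Parametrizing by [- d] turns the first ray into a half-line with upper end 0 at the vertex [z1],
   as [half_walk] requires. *)
have hom0 : homeo_on [set t : R | t - 0 <= 0] (stratum s0)
    (fun x => z1 + (x - 0) *: (- 1 *: d))
    (fun x => 0 + (a q x - a q z1) / a q (- 1 *: d)).
  have -> : stratum s0 = edge_points [set t | t <= 0] z1 (- 1 *: d).
    rewrite SJ JE; apply/seteqP; split=> _ [x /= x0 <-]; exists (- x).
    - by rewrite /= oppr_le0.
    - by rewrite scalerA mulrN1 opprK.
    - by rewrite /= oppr_ge0.
    - by rewrite scalerA mulrN1.
  by apply: edge_homeo; rewrite aZ mulN1r oppr_eq0 lt_eqF.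
have U1 : union_of [set s0]%SET = stratum s0.
  apply/seteqP; split=> [z [r]|z sz]; first by rewrite inE => /eqP ->.
  by exists s0; rewrite ?inE.
have hw : half_walk [set s0]%SET z1.
  split=> [r|| r z' tr rs rz]; first by rewrite inE => /eqP ->.
    do 2 eexists; exists 0; rewrite U1; split.
      rewrite (_ : [set t1 | t1 <= 0] = [set t : R | t - 0 <= 0]); first exact: hom0.
      by apply/seteqP; split=> x /=; rewrite subr0.
    by rewrite /= subrr scale0r addr0.
  by rewrite U1 => sz'; apply: (iso r) => //; move: rs; rewrite inE.
have [s' [ts' ss' s's]] := pivot ts st qt qs.
have [|w [f [g [sw [tw hom out] [s1 [z2 [d1 [ts1 s1s d1n ray1]]]]]]]] :=
  half_walk_ends hw ts' _ ss'; first by rewrite inE.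
have s0w : s0 \in w by move/fintype.subsetP: sw; apply; rewrite inE.
exists (union_of w), f, g; split=> //.
- apply: clopen_connected_component.
  + by exists s0 => //; have := ray 0 (lexx 0); rewrite scale0r addr0.
  + by move=> z [r rw rz]; exists r => //; apply: tw.
  + have [<- _ cf _] := hom; apply: connected_continuous_connected cf.
    by apply/connected_intervalP.
  + exact: closed_union_of.
  (* The unvisited strata are finite in number, so their union is closed, and a full walk does not
     meet it. *)
  + exists (union_of (finset (fun r => `[< selection r >] && (r \notin w)))).
      exact: closed_union_of.
    apply/seteqP; split=> z [].
      move=> [r tr rz] nz; split; exists r => //.
      rewrite inE; apply/andP; split; first exact/asboolP.
      by apply/negP => rw; apply: nz; exists r.
    move=> Nz [r]; rewrite inE => /andP[/asboolP tr rw] rz; split=> //.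
    exact: out rz.
- by move=> x x0; exists s0 => //; apply: ray.
- by exists s1, z2, d1; split=> //; move: s1s; rewrite inE.
Qed.
End Complementarity.

(** * Independence of tight constraints *)

Section LinearFunctionals.
Variables (K : fieldType) (V : vectType K) (I : finType) (a : I -> V -> K).
Hypothesis a_scalar : forall i, scalar (a i).

Definition eval_family (d : V) : {ffun I -> K^o} := [ffun i => a i d].

Lemma eval_family_linear : linear eval_family.
Proof. by move=> t u v; apply/ffunP => i; rewrite !ffunE a_scalar. Qed.

HB.instance Definition _ :=
  GRing.isLinear.Build K V {ffun I -> K^o} _ eval_family eval_family_linear.

(** Rank-nullity for the map collecting all values [a i d]; it translates between dimension counts
    and the freedom to prescribe values. *)
Lemma kernel_dim :
  exists W : {vspace V}, (forall d, d \in W <-> forall i, a i d = 0) /\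
    ((\dim W + #|I| = dim V)%N <->
     forall tau : I -> K, exists d, forall i, a i d = tau i).
Proof.
pose f := linfun eval_family.
exists (lker f); split=> [d|].
  rewrite memv_ker lfunE; split=> [/eqP/ffunP h i|h].
    by have := h i; rewrite !ffunE.
  by apply/eqP/ffunP => i; rewrite !ffunE h.
have dimE : (\dim (lker f) + \dim (limg f) = dim V)%N.
  by have := limg_ker_dim f fullv; rewrite capfv dimvf.
have dimF : \dim {:{ffun I -> K^o}} = #|I|.
  by rewrite dimvf; exact: muln1.
split=> [dW tau|surj].
  have full : limg f = fullv.
    apply/eqP; rewrite -(dimv_leqif_eq (subvf _)) dimF.
    by rewrite -(eqn_add2l (\dim (lker f))) dimE dW.
  have : [ffun i => tau i : K^o] \in limg f by rewrite full memvf.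
  case/memv_imgP => d _ e; exists d => i.
  by move/ffunP/(_ i): e; rewrite lfunE !ffunE.
rewrite -dimE -dimF; congr (_ + \dim _)%N.
apply/eqP; rewrite eqEsubv subvf andbT; apply/subvP => y _.
have [d hd] := surj y; apply/memv_imgP; exists d; first exact: memvf.
by rewrite lfunE; apply/ffunP => i; rewrite ffunE hd.
Qed.

End LinearFunctionals.

Section ScalarFunctions.
Variables (R : realType) (k : nat) (f : 'rV[R]_k -> R).
Hypothesis f_scalar : scalar f.

Lemma scalar0 : f 0 = 0.
Proof. by have := f_scalar (-1) 0 0; rewrite scaler0 addr0 mulN1r addNr. Qed.

Lemma scalar_sum (I : Type) (r : seq I) (c : I -> R) (p : I -> 'rV[R]_k) :
  f (\sum_(j <- r) c j *: p j) = \sum_(j <- r) c j * f (p j).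
Proof.
elim: r => [|j r IH]; first by rewrite !big_nil scalar0.
by rewrite !big_cons f_scalar IH.
Qed.

Lemma scalar_coord v : f v = \sum_i f (delta_mx 0 i) * v 0 i.
Proof.
rewrite {1}(row_sum_delta v) scalar_sum.
by apply: eq_bigr => i _; rewrite mulrC.
Qed.

Lemma scalar_continuous : continuous f.
Proof.
have -> : f = fun v => \sum_i f (delta_mx 0 i) * v 0 i.
  by apply/funext => v; exact: scalar_coord.
elim: (index_enum _) => [|j r IH] v.
  rewrite (_ : (fun v => _) = cst 0); first exact: cst_continuous.
  by apply/funext => w; rewrite big_nil.
rewrite (_ : (fun v => _) = fun v : 'rV[R]_k =>
    f (delta_mx 0 j) * v 0 j + \sum_(i <- r) f (delta_mx 0 i) * v 0 i).
  apply: (@continuousD _ _ _ (fun v : 'rV[R]_k => f (delta_mx 0 j) * v 0 j)).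
    by apply: continuousM; [exact: cst_continuous|exact: coord_continuous].
  exact: IH.
by apply/funext => w; rewrite big_cons.
Qed.

End ScalarFunctions.

(** The point [v] is relatively interior to the face [F] cut out by its own tight constraints, whose
    affine hull is [v] translated by the common kernel [W] of these constraints and of [h].
    Non-degeneracy gives the dimension of [W], and [kernel_dim] turns it into independence. *)
Lemma nondegenerate_indep (R : realType) (k l D : nat) (g : 'I_l -> 'rV[R]_k -> R)
    (h : 'rV[R]_k -> R) (v : 'rV[R]_k) :
  (forall q, scalar (g q)) -> scalar h ->
  Defs.nondegenerate [set v | (forall q, g q v <= 0) /\ h v = 1] g D -> k = D.+1 ->
  (forall q, g q v <= 0) -> h v = 1 ->
  forall (tau : 'I_l -> R) (s : R),
    exists d, (forall q, g q v = 0 -> g q d = tau q) /\ h d = s.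
Proof.
move=> gs hs nd kD gv hv; set S := [set v | _] in nd.
(* The element [None] stands for the normalization [h], which accounts for the difference between
   [k] and [D]. *)
pose I : finType := option {q | q \in label g v}.
pose a (i : I) : 'rV[R]_k -> R := if i is Some q then g (val q) else h.
have a_s i : scalar (a i) by case: i => [q|] /=.
have lab q : (q \in label g v) = (g q v == 0) by rewrite inE.
have [W [Wker Wdim]] := kernel_dim a_s.
have WP d : d \in W <-> (forall q, g q v = 0 -> g q d = 0) /\ h d = 0.
  rewrite Wker; split=> [hd|[gd hd] [[q qv]|]//=].
    split=> [q qv|]; last exact: (hd None).
    have qL : q \in label g v by rewrite lab qv.
    exact: (hd (Some (exist _ q qL))).
  by apply: gd; apply/eqP; rewrite -lab.
suff dimW : (\dim W + #|I| = dim 'rV[R]_k)%N.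
  move=> tau s; have [d hd] := (Wdim.1 dimW) (fun i => if i is Some q then tau (val q) else s).
  exists d; split=> [q qv|]; last exact: (hd None).
  have qL : q \in label g v by rewrite lab qv.
  exact: (hd (Some (exist _ q qL))).
pose F : set 'rV[R]_k := [set u | S u /\ forall q, g q v = 0 -> g q u = 0].
have Fv : F v by split.
have faceF : face S F.
  (* The sum of the constraints tight at [v] supports [F]: non-positive terms add up to 0 only if
     each of them is 0. *)
  exists (\row_i \sum_(q in label g v) g q (delta_mx 0 i)), 0.
  have cE (u : 'rV[R]_k) : \sum_i (\row_i \sum_(q in label g v) g q (delta_mx 0 i)) 0 i * u 0 i
      = \sum_(q in label g v) g q u.
    under eq_bigr do rewrite mxE mulr_suml.
    rewrite exchange_big /=; apply: eq_bigr => q _.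
    by rewrite -scalar_coord.
  split=> [u [gu _]|]; first by rewrite cE sumr_le0.
  apply/seteqP; split=> u [Su hu]; split=> //.
    by rewrite cE big1 // => q; rewrite lab => /eqP; exact: hu.
  move: hu; rewrite cE => hu q qv; apply/eqP; rewrite -oppr_eq0; apply/eqP.
  apply: (@psumr_eq0P _ _ (mem (label g v)) (fun q => - g q u)).
  - by move=> q' _; rewrite oppr_ge0; apply: Su.1.
  - by rewrite sumrN hu oppr0.
  - by rewrite /= lab qv.
have nearv : \forall w \near v, forall q, g q v != 0 -> g q w < 0.
  apply: (@filter_forall _ _ (fun q w => g q v != 0 -> g q w < 0) (nbhs v)) => q.
  have [qv|qv] := eqVneq (g q v) 0.
    exact: filterE.
  have qv0 : g q v < 0 by rewrite lt_neqAle qv gv.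
  have := @cvgr_lt _ _ _ _ _ _ (scalar_continuous (gs q) (x:=v)) _ qv0.
  by move=> near_lt; near=> w => _; near: w; exact: near_lt.
have inF w : w - v \in W -> (forall q, g q v != 0 -> g q w < 0) -> F w.
  move=> /WP[gd hd] gw.
  have wE : w = 1 *: (w - v) + v by rewrite scale1r subrK.
  have gw0 q : g q v = 0 -> g q w = 0.
    by move=> qv; rewrite wE gs gd // qv mulr0 addr0.
  split; [split=> [q|]|exact: gw0].
    by have [/gw0->|/gw/ltW] := eqVneq (g q v) 0.
  by rewrite wE hs hd hv mulr0 add0r.
have hull : affine_hull F = [set w | w - v \in W].
  apply/seteqP; split=> w /=.
    move=> [r [p [c [Fp c1 ->]]]]; apply/WP.
    have subE f : scalar f -> f (\sum_i c i *: p i - v) = \sum_i c i * f (p i) - f v.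
      by move=> fs; rewrite addrC -scaleN1r fs scalar_sum // mulN1r addrC.
    split=> [q qv|]; rewrite subE //.
      by rewrite qv subr0 big1 // => i _; have [_ ->] := Fp i; rewrite ?mulr0.
    by rewrite hv -c1 -sumrB big1 // => i _; have [[_ ->] _] := Fp i; rewrite mulr1 subrr.
  move=> wW.
  (* A point at a small fraction [t] of the way from [v] to [w] lies in [F]; [w] is then its affine
     combination with [v], with weights [t^-1] and [1 - t^-1]. *)
  have [t [t0 Ft]] : exists t, 0 < t /\ F (v + t *: (w - v)).
    have near0 : \forall t \near (0 : R)^'+,
        forall q, g q v != 0 -> g q (v + t *: (w - v)) < 0.
      have cv : (v + t *: (w - v)) @[t --> (0 : R)^'+] --> v.
        apply: cvg_at_right_filter; rewrite -[X in _ --> X]addr0 -(scale0r (w - v)).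
        by apply: cvgD; [exact: cvg_cst|apply: cvgZ; [exact: cvg_id|exact: cvg_cst]].
      exact: cv nearv.
    have [t [t0 tq]] := filter_ex (filterI (nbhs_right_gt (0 : R)) near0).
    exists t; split=> //; apply: inF => //.
    by rewrite addrC addKr memvZ.
  exists 2%N, (fun i : 'I_2 => if i == 0 then v + t *: (w - v) else v).
  exists (fun i : 'I_2 => if i == 0 then t^-1 else 1 - t^-1); split.
  - by move=> i; case: ifP.
  - by rewrite big_ord_recl big_ord1 /= addrC subrK.
  - rewrite big_ord_recl big_ord1 /= scalerDr scalerA mulVf ?gt_eqF // scale1r.
    by rewrite scalerBl scale1r -addrA (addrA (w - v)) subrK addrC subrK.
have dF : has_dim F (\dim W) by exists v, W.
have ri : relative_interior F v.
  split=> //; near=> w; rewrite hull => wW; apply: inF => //; near: w; exact: nearv.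
have eD := nd _ _ _ faceF dF ri.
rewrite dim_matrix (_ : (1 * _)%R = k); last exact: mul1n.
rewrite [in RHS]kD -eD.
by rewrite card_option card_sig addnC; congr (_.+1 + _)%N; apply: eq_card.
Unshelve. all: by end_near. Qed.

(** * Best-response polyhedra *)

Section BestResponse.
Variables (R : realType) (m n : nat) (A C : 'M[R]_(m, n)) (beta : 'rV[R]_n).

Lemma P_ineqL i v : P_ineq A (lshift n i) v = (A *m (P_y v)^T) i 0 - P_pi1 v.
Proof. by rewrite /P_ineq (unsplitK (inl i)). Qed.

Lemma P_ineqR j v : P_ineq A (rshift m j) v = - P_y v 0 j.
Proof. by rewrite /P_ineq (unsplitK (inr j)). Qed.

Lemma Q_ineqL i w : Q_ineq C beta (lshift n i) w = - Q_x w 0 i.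
Proof. by rewrite /Q_ineq (unsplitK (inl i)). Qed.

Lemma Q_ineqR j w : Q_ineq C beta (rshift m j) w =
  (Q_x w *m C) 0 j + beta 0 j * Q_lambda w - Q_pi2 w.
Proof. by rewrite /Q_ineq (unsplitK (inr j)). Qed.

Lemma P_y_linear : linear (@P_y R n).
Proof. by move=> t v w; rewrite /P_y linearP. Qed.

Lemma P_pi1_scalar : scalar (@P_pi1 R n).
Proof. by move=> t v w; rewrite /P_pi1 linearP !mxE. Qed.

Lemma Q_x_linear : linear (@Q_x R m).
Proof. by move=> t v w; rewrite /Q_x linearP. Qed.

Lemma Q_lambda_scalar : scalar (@Q_lambda R m).
Proof. by move=> t v w; rewrite /Q_lambda linearP !mxE. Qed.

Lemma Q_pi2_scalar : scalar (@Q_pi2 R m).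
Proof. by move=> t v w; rewrite /Q_pi2 linearP !mxE. Qed.

Lemma P_ineq_scalar q : scalar (P_ineq A q).
Proof.
move=> t v w; case: (split_ordP q) => i ->; rewrite ?P_ineqL ?P_ineqR P_y_linear.
  rewrite P_pi1_scalar linearP /= mulmxDr -scalemxAr mxE [X in X + _ - _]mxE.
  by ring.
by rewrite !mxE; ring.
Qed.

Lemma Q_ineq_scalar q : scalar (Q_ineq C beta q).
Proof.
move=> t v w; case: (split_ordP q) => i ->; rewrite ?Q_ineqL ?Q_ineqR Q_x_linear.
  by rewrite !mxE; ring.
rewrite Q_lambda_scalar Q_pi2_scalar mulmxDl -scalemxAl.
by rewrite mxE [X in X + _ + _ - _]mxE; ring.
Qed.

Definition P_sum (v : 'rV[R]_(n + 1)) : R := \sum_j P_y v 0 j.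
Definition Q_sum (w : 'rV[R]_(m + 2)) : R := \sum_i Q_x w 0 i.

Lemma P_sum_scalar : scalar P_sum.
Proof.
move=> t v w; rewrite /P_sum P_y_linear mulr_sumr -big_split /=.
by apply: eq_bigr => j _; rewrite !mxE.
Qed.

Lemma Q_sum_scalar : scalar Q_sum.
Proof.
move=> t v w; rewrite /Q_sum Q_x_linear mulr_sumr -big_split /=.
by apply: eq_bigr => j _; rewrite !mxE.
Qed.

Lemma P_ext (v w : 'rV[R]_(n + 1)) : P_y v = P_y w -> P_pi1 v = P_pi1 w -> v = w.
Proof.
move=> ey ep; rewrite -[v]hsubmxK -[w]hsubmxK; congr row_mx; first exact: ey.
by apply/rowP => i; rewrite !ord1.
Qed.

Lemma Q_ext (v w : 'rV[R]_(m + 2)) : Q_x v = Q_x w -> Q_lambda v = Q_lambda w ->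
  Q_pi2 v = Q_pi2 w -> v = w.
Proof.
move=> ex el ep; rewrite -[v]hsubmxK -[w]hsubmxK; congr row_mx; first exact: ex.
by apply/rowP => -[[|[|//]] hi]; [move: el|move: ep];
  rewrite /Q_lambda /Q_pi2 => e; apply: etrans (etrans e _); congr (_ _ _);
  apply/val_inj.
Qed.

Definition P_point (y : 'rV[R]_n) (p : R) : 'rV[R]_(n + 1) := row_mx y (const_mx p).
Definition Q_point (x : 'rV[R]_m) (t p : R) : 'rV[R]_(m + 2) :=
  row_mx x (\row_i if i == ord0 then t else p).

Lemma P_pointK y p : P_y (P_point y p) = y /\ P_pi1 (P_point y p) = p.
Proof. by rewrite /P_y /P_pi1 row_mxKl row_mxKr mxE. Qed.

Lemma Q_pointK x t p : [/\ Q_x (Q_point x t p) = x,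
  Q_lambda (Q_point x t p) = t & Q_pi2 (Q_point x t p) = p].
Proof. by rewrite /Q_x /Q_lambda /Q_pi2 row_mxKl row_mxKr !mxE. Qed.

(** * The complementarity system of the two polyhedra *)

Local Notation V := ('rV[R]_(n + 1) * 'rV[R]_(m + 2))%type.

(* [Some (true, _)] stands for the constraints on P and [Some (false, _)] for
   those on Q', an inner [None] being the normalization.  The outer [None] is an
   additional constraint [c <= s * lambda] that shares the slot of the label [k],
   so that on the slice [s * lambda = c] the label [k] may be missing; for
   [s = 0] and [c = -1] it is void and the complementary set is N itself. *)
Definition constraint : finType := option (bool * option 'I_(m + n)).
Definition slot : finType := ('I_(m + n) + bool)%type.

(** The slot of a label holds its inequality in each polyhedron, so a tight one among them means
    that the label occurs. A normalization is alone in its slot and is thereby forced to be an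
    equality. *)
Definition slot_of (k : 'I_(m + n)) (t : constraint) : slot :=
  match t with
  | Some (_, Some q) => inl q
  | Some (b, None) => inr b
  | None => inl k
  end.

Definition grad (s : R) (t : constraint) (z : V) : R :=
  match t with
  | Some (true, Some q) => P_ineq A q z.1
  | Some (false, Some q) => Q_ineq C beta q z.2
  | Some (true, None) => P_sum z.1
  | Some (false, None) => Q_sum z.2
  | None => - s * Q_lambda z.2
  end.

Definition offset (c : R) (t : constraint) : R :=
  match t with
  | Some (_, Some _) => 0
  | Some (_, None) => - 1
  | None => c
  end.

Lemma grad_scalar s t : scalar (grad s t).
Proof.
move=> x z z'; case: t => [[[] [q|]]|] /=.
- exact: P_ineq_scalar.
- exact: P_sum_scalar.
- exact: Q_ineq_scalar.
- exact: Q_sum_scalar.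
- by rewrite Q_lambda_scalar; ring.
Qed.

Lemma grad_continuous s t : continuous (grad s t).
Proof.
have c1 (f : 'rV[R]_(n + 1) -> R) : scalar f -> continuous (fun z : V => f z.1).
  move=> fs z; apply: (@continuous_comp _ _ _ fst f).
    exact: cvg_fst.
  exact: scalar_continuous.
have c2 (f : 'rV[R]_(m + 2) -> R) : scalar f -> continuous (fun z : V => f z.2).
  move=> fs z; apply: (@continuous_comp _ _ _ snd f).
    exact: cvg_snd.
  exact: scalar_continuous.
case: t => [[[] [q|]]|] /=.
- exact/c1/P_ineq_scalar.
- exact/c1/P_sum_scalar.
- exact/c2/Q_ineq_scalar.
- exact/c2/Q_sum_scalar.
- apply: (c2 (fun w => - s * Q_lambda w)) => x w w'.
  by rewrite Q_lambda_scalar; ring.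
Qed.

Hypothesis m_gt0 : (0 < m)%N.
Hypothesis hP : nondegenerate_P A.
Hypothesis hQ : nondegenerate_Q C beta.

Lemma n_gt0 : (0 < n)%N.
Proof.
rewrite lt0n; apply/negP => /eqP n0; case: hQ => _ []; exists 0 => j.
by have := ltn_ord j; rewrite {2}n0.
Qed.

(** The sign constraints kill [x] and [y], and a row then kills [pi1]. The columns leave
    [beta_j * lambda = pi2] for every [j], so a non-zero [lambda] would make [beta] constant. *)
Lemma grad_pointed s d : (forall t, grad s t d = 0) -> d = 0.
Proof.
move=> h; have y0 : P_y d.1 = 0.
  apply/rowP => j; have /= := h (Some (true, Some (rshift m j))).
  by rewrite P_ineqR [X in _ -> _ = X]mxE => /eqP; rewrite oppr_eq0 => /eqP.
have x0 : Q_x d.2 = 0.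
  apply/rowP => i; have /= := h (Some (false, Some (lshift n i))).
  by rewrite Q_ineqL [X in _ -> _ = X]mxE => /eqP; rewrite oppr_eq0 => /eqP.
have p0 : P_pi1 d.1 = 0.
  have /= := h (Some (true, Some (lshift n (Ordinal m_gt0)))).
  by rewrite P_ineqL y0 trmx0 mulmx0 mxE; lra.
have col j : beta 0 j * Q_lambda d.2 = Q_pi2 d.2.
  have /= := h (Some (false, Some (rshift m j))).
  by rewrite Q_ineqR x0 mul0mx mxE; lra.
have l0 : Q_lambda d.2 = 0.
  apply/eqP; apply: contraT => l0; case: hQ => _ []; exists (Q_pi2 d.2 / Q_lambda d.2).
  by move=> j; rewrite -(col j) mulfK.
have q0 : Q_pi2 d.2 = 0 by rewrite -(col (Ordinal n_gt0)) l0 mulr0.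
rewrite [d]surjective_pairing; congr pair.
  by apply: P_ext; rewrite ?y0 ?p0 /P_y /P_pi1 ?linear0 ?mxE.
by apply: Q_ext; rewrite ?x0 ?l0 ?q0 /Q_x /Q_lambda /Q_pi2 ?linear0 ?mxE.
Qed.

Section Walks.
Variables (s c : R) (k : 'I_(m + n)).

Local Notation gap := (slack (grad s) (offset c)).
Local Notation stratum := (stratum (grad s) (offset c)).
Local Notation selection := (selection (slot_of k)).
Local Notation complementary :=
  (complementary (slot_of k) (grad s) (offset c)).

Lemma gapE (z : V) :
  [/\ forall q, gap (Some (true, Some q)) z = P_ineq A q z.1,
      forall q, gap (Some (false, Some q)) z = Q_ineq C beta q z.2,
      gap (Some (true, None)) z = P_sum z.1 - 1,
      gap (Some (false, None)) z = Q_sum z.2 - 1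
    & gap None z = c - s * Q_lambda z.2].
Proof. by split=> *; rewrite /slack /= ?addr0 // mulNr addrC. Qed.

Lemma selection_inr t b : selection t -> t (inr b) = Some (b, None).
Proof. by move/(_ (inr b)); case: (t (inr b)) => [[b' [q|]]|] //= [->]. Qed.

Lemma selection_inl t q : selection t ->
  (exists b, t (inl q) = Some (b, Some q)) \/ (q = k /\ t (inl q) = None).
Proof.
move/(_ (inl q)); case: (t (inl q)) => [[b [q'|]]|] //= [->]; last by right.
by left; exists b.
Qed.

Lemma stratum_poly t z : selection t -> stratum t z ->
  Defs.polyP A z.1 /\ polyQ C beta z.2.
Proof.
have [eP eQ eP1 eQ1 _] := gapE z => tt [zle zt]; split; split.
- by move=> q; rewrite -eP.
- have := zt (inr true); rewrite (selection_inr _ tt) eP1 => /eqP.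
  by rewrite subr_eq0 => /eqP.
- by move=> q; rewrite -eQ.
- have := zt (inr false); rewrite (selection_inr _ tt) eQ1 => /eqP.
  by rewrite subr_eq0 => /eqP.
Qed.

Lemma P_indep v : Defs.polyP A v -> forall (tau : 'I_(m + n) -> R) (r : R),
  exists d, (forall q, P_ineq A q v = 0 -> P_ineq A q d = tau q) /\ P_sum d = r.
Proof.
move=> [vle v1]; apply: (nondegenerate_indep P_ineq_scalar P_sum_scalar hP) => //.
by rewrite addn1.
Qed.

Lemma Q_indep w : polyQ C beta w -> forall (tau : 'I_(m + n) -> R) (r : R),
  exists d, (forall q, Q_ineq C beta q w = 0 -> Q_ineq C beta q d = tau q) /\
    Q_sum d = r.
Proof.
move=> [wle w1].
apply: (nondegenerate_indep Q_ineq_scalar Q_sum_scalar hQ.1) => //.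
by rewrite addn2.
Qed.

(** Transversality of the slice: [lambda] can still vary when all tight constraints of Q' are kept
    fixed. *)
Hypothesis slice_generic : forall w, polyQ C beta w -> c - s * Q_lambda w = 0 ->
  exists e, [/\ forall q, Q_ineq C beta q w = 0 -> Q_ineq C beta q e = 0,
    Q_sum e = 0 & s * Q_lambda e != 0].

Lemma grad_indep z : complementary z -> forall tau : constraint -> R,
  exists d : V, forall q, gap q z = 0 -> grad s q d = tau q.
Proof.
move=> [t tt tz] tau; have [zP zQ] := stratum_poly tt tz.
have [eP eQ eP1 eQ1 e0] := gapE z.
have [dP [hdP sP]] := P_indep zP (fun q => tau (Some (true, Some q)))
  (tau (Some (true, None))).
have [dQ [hdQ sQ]] := Q_indep zQ (fun q => tau (Some (false, Some q)))
  (tau (Some (false, None))).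
have [/(slice_generic zQ)[e [he se le]]|nz] := eqVneq (c - s * Q_lambda z.2) 0.
  (* A multiple of [e] corrects the value of the slice constraint without disturbing the values
     already prescribed. *)
  pose x := (- s * Q_lambda dQ - tau None) / (s * Q_lambda e).
  exists (dP, x *: e + dQ) => -[[[] [q|]]|] /=.
  - by rewrite eP => /hdP.
  - by [].
  - by rewrite eQ => qz; rewrite Q_ineq_scalar he // mulr0 add0r hdQ.
  - by rewrite Q_sum_scalar se mulr0 add0r.
  - move=> _; rewrite Q_lambda_scalar.
    have : x * (s * Q_lambda e) = - s * Q_lambda dQ - tau None by rewrite divfK.
    by lra.
exists (dP, dQ) => -[[[] [q|]]|] /=.
- by rewrite eP => /hdP.
- by [].
- by rewrite eQ => /hdQ.
- by [].
- by rewrite e0 => /eqP; rewrite (negPf nz).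
Qed.

(** There are [m + n + 2] slots in a space of dimension [m + n + 3], so independent gradients leave
    a kernel of dimension one. *)
Lemma grad_line t z : selection t -> stratum t z ->
  exists e : V, [/\ e != 0, forall u, grad s (t u) e = 0
    & forall d, (forall u, grad s (t u) d = 0) -> exists x, d = x *: e].
Proof.
move=> tt tz.
have [W [Wker Wdim]] := kernel_dim (fun u => grad_scalar s (t u)).
have dimW : \dim W = 1%N.
  have surj (tau : slot -> R) : exists d, forall u, grad s (t u) d = tau u.
    have Nz : complementary z by exists t.
    have [d hd] := grad_indep Nz (fun q => tau (slot_of k q)).
    by exists d => u; rewrite hd ?tt //; case: tz => _ ->.
  have := Wdim.2 surj; rewrite card_sum card_ord card_bool.
  have -> : dim V = (1 * (n + 1) + 1 * (m + 2))%N by [].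
  by lia.
exists (vpick W); split.
- by rewrite vpick0 -dimv_eq0 dimW.
- by apply/Wker; exact: memv_pick.
- move=> d /Wker dW; apply/vlineP.
  suff -> : <[vpick W]>%VS = W by [].
  have sub : (<[vpick W]> <= W)%VS by rewrite -memvE memv_pick.
  apply/eqP; rewrite -(dimv_leqif_eq sub).
  by rewrite dim_vline vpick0 -dimv_eq0 dimW.
Qed.

Definition walk_component :=
  ray_component (grad_scalar s) (@grad_continuous s) (@grad_pointed s)
    grad_indep grad_line.

Lemma walk_recession (t : {ffun slot -> constraint}) z d : (forall x, 0 <= x -> stratum t (z + x *: d)) ->
  (forall u, grad s (t u) d = 0) /\ forall q, grad s q d <= 0.
Proof. exact: (recession (grad_scalar s)). Qed.

Lemma stratum_setN t z : selection t -> (forall q, t (inl q) != None) ->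
  stratum t z -> setN A C beta z.
Proof.
move=> tt tN tz; have [zP zQ] := stratum_poly tt tz; split=> //.
have [eP eQ _ _ _] := gapE z; have [_ zt] := tz.
apply/setP => q; rewrite !inE; have := zt (inl q).
case: (selection_inl q tt) => [[[] ->]|[_ /eqP]]; last by rewrite (negPf (tN q)).
  by rewrite eP => ->; rewrite eqxx.
by rewrite eQ => ->; rewrite eqxx orbT.
Qed.

(** The stratum over the pure pair [(i0, j0)]: row [i0] determines [pi1], the slice constraint fills
    the slot of column [j0], and only [pi2] remains free. *)
Definition vertical (i0 : 'I_m) (j0 : 'I_n) : {ffun slot -> constraint} :=
  [ffun u => match u with
    | inr b => Some (b, None)
    | inl q => match fintype.split q with
      | inl i => Some (i == i0, Some q)
      | inr j => if j == j0 then None else Some (true, Some q)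
      end
    end].

(** * Rays when the missing label is a column *)

Section ColumnSlot.
Variable j0 : 'I_n.
Hypothesis kE : k = rshift m j0.

Lemma selection_row t i : selection t ->
  exists b, t (inl (lshift n i)) = Some (b, Some (lshift n i)).
Proof.
move=> tt; case: (selection_inl (lshift n i) tt) => [//|[]].
by rewrite kE => /eqP; rewrite eq_lrshift.
Qed.

(** If every row label came from Q', all [x_i] would vanish, against the normalization. *)
Lemma supported_row t z : selection t -> stratum t z ->
  exists i, t (inl (lshift n i)) = Some (true, Some (lshift n i)).
Proof.
move=> tt tz; apply: contrapT => norow.
have [_ [_ x1]] := stratum_poly tt tz; have [_ eQ _ _ _] := gapE z.
move: x1; rewrite big1 => [/eqP|i _]; first by rewrite eq_sym oner_eq0.
have [_ /(_ (inl (lshift n i)))] := tz.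
have [[] ti] := selection_row i tt; first by case: norow; exists i.
by rewrite ti eQ Q_ineqL => /eqP; rewrite oppr_eq0 => /eqP.
Qed.

(** The [x] and [y] parts of a recession direction are non-negative with sum zero, and a tight row
    of P then fixes [pi1]. Only [lambda] and [pi2] can be unbounded. *)
Lemma ray_direction t z d : selection t -> d != 0 ->
  (forall x, 0 <= x -> stratum t (z + x *: d)) ->
  [/\ P_y d.1 = 0, P_pi1 d.1 = 0, Q_x d.2 = 0 &
    Q_lambda d.2 = 0 -> 0 < Q_pi2 d.2].
Proof.
move=> tt d0 ray; have [dt dle] := walk_recession ray.
have tz : stratum t z by have := ray 0 (lexx 0); rewrite scale0r addr0.
have y0 : P_y d.1 = 0.
  apply/rowP => j; rewrite [RHS]mxE.
  apply: (@psumr_eq0P _ _ predT (fun j => P_y d.1 0 j)) => //.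
    move=> i _; have := dle (Some (true, Some (rshift m i))).
    by rewrite /= P_ineqR oppr_le0.
  by have := dt (inr true); rewrite (selection_inr _ tt).
have x0 : Q_x d.2 = 0.
  apply/rowP => i; rewrite [RHS]mxE.
  apply: (@psumr_eq0P _ _ predT (fun i => Q_x d.2 0 i)) => //.
    move=> j _; have := dle (Some (false, Some (lshift n j))).
    by rewrite /= Q_ineqL oppr_le0.
  by have := dt (inr false); rewrite (selection_inr _ tt).
have p0 : P_pi1 d.1 = 0.
  have [i ti] := supported_row tt tz.
  have := dt (inl (lshift n i)); rewrite ti /= P_ineqL y0 trmx0 mulmx0 mxE.
  by rewrite add0r => /eqP; rewrite oppr_eq0 => /eqP.
split=> // l0; rewrite lt_neqAle; apply/andP; split.
  apply: contra_neq d0 => q0; rewrite [d]surjective_pairing; congr pair.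
    by apply: P_ext; rewrite ?y0 ?p0 /P_y /P_pi1 ?linear0 ?mxE.
  by apply: Q_ext; rewrite ?x0 ?l0 -?q0 /Q_x /Q_lambda /Q_pi2 ?linear0 ?mxE.
have := dle (Some (false, Some (rshift m j0))).
by rewrite /= Q_ineqR x0 mul0mx mxE l0 mulr0 !add0r oppr_le0.
Qed.

(** With [lambda] fixed, [pi2] increases and no column of Q' stays tight. So [y_j = 0] for every [j]
    other than [j0], and [y] is the pure strategy [j0]; non-degeneracy of P makes the best reply to
    it unique. *)
Lemma vertical_ray i0 t z d : (forall i, A i j0 <= A i0 j0) ->
  selection t -> d != 0 -> (forall x, 0 <= x -> stratum t (z + x *: d)) ->
  Q_lambda d.2 = 0 -> t = vertical i0 j0.
Proof.
move=> max0 tt d0 ray l0; have [dt dle] := walk_recession ray.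
have tz : stratum t z by have := ray 0 (lexx 0); rewrite scale0r addr0.
have [[zPle y1] zQ] := stratum_poly tt tz; have [_ zt] := tz.
have [eP eQ _ _ _] := gapE z.
have [_ _ x0 /(_ l0) q0] := ray_direction tt d0 ray.
have col j b : t (inl (rshift m j)) = Some (b, Some (rshift m j)) -> b = true.
  case: b => // tj; have := dt (inl (rshift m j)).
  rewrite tj /= Q_ineqR x0 mul0mx mxE l0 mulr0 !add0r => /eqP.
  by rewrite oppr_eq0 gt_eqF.
have ycol j : t (inl (rshift m j)) = Some (true, Some (rshift m j)) ->
    P_y z.1 0 j = 0.
  move=> tj; have := zt (inl (rshift m j)).
  by rewrite tj eP P_ineqR => /eqP; rewrite oppr_eq0 => /eqP.
have tcol j : j != j0 -> t (inl (rshift m j)) = Some (true, Some (rshift m j)).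
  move=> jj; case: (selection_inl (rshift m j) tt) => [[b tj]|[]].
    by rewrite tj (col j b).
  by rewrite kE => /rshift_inj/eqP; rewrite (negPf jj).
have yj0 : P_y z.1 0 j0 = 1.
  rewrite -y1 (bigD1 j0) //= big1 ?addr0 // => j jj.
  by rewrite ycol // tcol.
have tj0 : t (inl (rshift m j0)) = None.
  case: (selection_inl (rshift m j0) tt) => [[b tj]|[]//].
  have b1 := col j0 b tj; rewrite b1 in tj.
  by have := ycol j0 tj; rewrite yj0 => /eqP; rewrite oner_eq0.
have rowE i : P_ineq A (lshift n i) z.1 = A i j0 - P_pi1 z.1.
  rewrite P_ineqL [(A *m _) i 0]mxE (bigD1 j0) //= big1 ?addr0.
    by rewrite [_^T j0 0]mxE yj0 mulr1.
  by move=> j jj; rewrite [_^T j 0]mxE ycol ?mulr0 // tcol.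
have tight_row i : t (inl (lshift n i)) = Some (true, Some (lshift n i)) -> i = i0.
  move=> ti; have := zt (inl (lshift n i)); rewrite ti eP => rowi.
  have rowi0 : P_ineq A (lshift n i0) z.1 = 0.
    apply/le_anti; rewrite zPle /=; have := max0 i.
    by move: rowi; rewrite !rowE => rowi; lra.
  apply/eqP; apply: contraT => ii0.
  (* If rows [i] and [i0] were both tight, independence would give a direction with zero [y] part on
     which they take the values 1 and 0, although both equal [- P_pi1 e] there. *)
  have [e [he es]] := P_indep (conj zPle y1) (fun q => (q == lshift n i)%:R) 0.
  have ye j : j != j0 -> P_y e 0 j = 0.
    move=> jj; have := he (rshift m j).
    rewrite !P_ineqR eq_rlshift ycol ?tcol // oppr0 => /(_ erefl)/eqP.
    by rewrite oppr_eq0 => /eqP.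
  have y0 : P_y e = 0.
    apply/rowP => j; rewrite [RHS]mxE; have [->|/ye//] := eqVneq j j0.
    by move: es; rewrite /P_sum (bigD1 j0) //= big1 ?addr0.
  have := he _ rowi; have := he _ rowi0.
  have rowe i' : P_ineq A (lshift n i') e = - P_pi1 e.
    by rewrite P_ineqL y0 trmx0 mulmx0 mxE add0r.
  rewrite !rowe eqxx (inj_eq (@lshift_inj _ _)) eq_sym (negPf ii0) => ->.
  by move/eqP; rewrite eq_sym oner_eq0.
apply/ffunP => -[q|b]; rewrite ffunE; last exact: selection_inr.
case: (split_ordP q) => [i ->|j ->]; last first.
  by have [->|/tcol] := eqVneq j j0.
have [->|ii0] := eqVneq i i0.
  by have [i1 ti1] := supported_row tt tz; rewrite -(tight_row i1 ti1).
have [[] ti] := selection_row i tt => //.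
by move: ii0; rewrite (tight_row i ti) eqxx.
Qed.

End ColumnSlot.
End Walks.

(** * Slices at large [lambda] and the Lemke-Howson path *)

Lemma slice_bound : exists M : R, forall w, polyQ C beta w ->
  M < `|Q_lambda w| ->
  exists e, [/\ forall q, Q_ineq C beta q w = 0 -> Q_ineq C beta q e = 0,
    Q_sum e = 0 & Q_lambda e != 0].
Proof.
pose good w := exists e, [/\ forall q, Q_ineq C beta q w = 0 -> Q_ineq C beta q e = 0,
  Q_sum e = 0 & Q_lambda e != 0].
(* Two points with the same label and different [lambda] differ by a direction that is good for
   both. So one bad point [w0] bounds [lambda] on all the bad points with its label. *)
have bound (J : {set 'I_(m + n)}) : exists M, 0 <= M /\ forall w, polyQ C beta w ->
    label (Q_ineq C beta) w = J -> M < `|Q_lambda w| -> good w.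
  have [[w0 [w0Q w0J w0g]]|h] := pselect (exists w, [/\ polyQ C beta w,
      label (Q_ineq C beta) w = J & ~ good w]); last first.
    exists 0; split=> // w wQ wJ _; apply: contrapT => wg; apply: h.
    by exists w.
  exists `|Q_lambda w0|; split=> // w wQ wJ lt_w; apply: contrapT => wg.
  have tight q : Q_ineq C beta q w = 0 -> Q_ineq C beta q w0 = 0.
    move=> /eqP qw; apply/eqP; have : q \in label (Q_ineq C beta) w by rewrite inE.
    by rewrite wJ -w0J inE.
  apply: wg; exists (- 1 *: w0 + w); split.
  - by move=> q qw; rewrite Q_ineq_scalar qw tight // mulr0 addr0.
  - by rewrite Q_sum_scalar; case: wQ => _; case: w0Q => _;
      rewrite /Q_sum => -> ->; rewrite mulN1r addNr.
  - rewrite Q_lambda_scalar mulN1r addrC subr_eq0.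
    by apply: contraTneq lt_w => ->; rewrite ltxx.
(* There are finitely many labels, and the sum of the non-negative bounds dominates each of them. *)
have [f hf] := choice bound; exists (\sum_J f J) => w wQ lt_w.
have [f0 fP] := hf (label (Q_ineq C beta) w); apply: fP => //.
apply: le_lt_trans lt_w; rewrite (bigD1 (label (Q_ineq C beta) w)) //=.
by rewrite lerDl sumr_ge0 // => J _; have [] := hf J.
Qed.

Lemma setN_complementary k :
  setN A C beta = complementary (slot_of k) (grad 0) (offset (- 1)).
Proof.
apply/seteqP; split=> z.
  move=> [[zP z1] [zQ x1] /setP lab].
  have [eP eQ eP1 eQ1 e0] := gapE 0 (- 1) z.
  exists [ffun u => match u with
    | inl q => Some (P_ineq A q z.1 == 0, Some q)
    | inr b => Some (b, None)
    end].
    by case=> [q|b]; rewrite ffunE.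
  split=> [[[[] [q|]]|]|[q|[]]].
  - by rewrite eP.
  - by rewrite eP1 /P_sum z1 subrr.
  - by rewrite eQ.
  - by rewrite eQ1 /Q_sum x1 subrr.
  - by rewrite e0 mul0r subr0 lerN10.
  - rewrite ffunE; case: eqP => [qz|qz]; first by rewrite eP.
    rewrite eQ; have := lab q; rewrite !inE => /orP[/eqP//|/eqP//].
  - by rewrite ffunE eP1 /P_sum z1 subrr.
  - by rewrite ffunE eQ1 /Q_sum x1 subrr.
move=> [t tt tz]; apply: (stratum_setN tt _ tz) => q; apply/eqP => tq.
have [_ _ _ _ e0] := gapE 0 (- 1) z.
have [_ /(_ (inl q))] := tz.
by rewrite tq e0 mul0r subr0 => /eqP; rewrite oppr_eq0 oner_eq0.
Qed.

Lemma vertical_selection i0 j0 : selection (slot_of (rshift m j0)) (vertical i0 j0).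
Proof.
case=> [q|b]; rewrite ffunE //; case: (split_ordP q) => [i ->|j ->] //.
by case: eqP => [->|].
Qed.

(* The Lemke-Howson path in the slice [s * lambda = c] with missing label
   [rshift m j0] starts on the vertical ray [pi2 -> +oo] over pure strategies;
   its other ray has unbounded [s * lambda]. *)
Lemma far_ray s : s * s = 1 -> exists c k t z d,
  [/\ selection (slot_of k) t, forall q, t (inl q) != None, d != 0,
    0 < s * Q_lambda d.2
  & forall x, 0 <= x -> stratum (grad s) (offset c) t (z + x *: d)].
Proof.
(* As [s * s = 1], every point of the slice has [lambda] equal to [s * c], of absolute value
   [c > M], where [slice_bound] gives transversality. *)
move=> s2; have [M MP] := slice_bound; pose c := `|M| + 1.
pose j0 : 'I_n := Ordinal n_gt0; pose k := rshift m j0.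
have gen w : polyQ C beta w -> c - s * Q_lambda w = 0 ->
    exists e, [/\ forall q, Q_ineq C beta q w = 0 -> Q_ineq C beta q e = 0,
      Q_sum e = 0 & s * Q_lambda e != 0].
  move=> wQ wc; have s0 : s != 0.
    by apply: contra_eq_neq s2 => ->; rewrite mul0r eq_sym oner_neq0.
  have [|e [he es el]] := MP w wQ; last by exists e; split=> //; rewrite mulf_neq0.
  have wE : Q_lambda w = s * c by rewrite -[LHS]mul1r -s2 -mulrA; congr (s * _); lra.
  have ns : `|s| = 1.
    apply/eqP; rewrite -(@eqrXn2 _ 2%N) // ?expr1n ?normr_ge0 //.
    by rewrite -normrX expr2 s2 normr1.
  rewrite wE normrM ns mul1r /c ger0_norm ?addr_ge0 //.
  by rewrite (le_lt_trans (ler_norm M)) // ltrDl.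
have [i0 max0] : exists i0, forall i, A i j0 <= A i0 j0.
  have [i0 _ h] := @arg_maxP _ R _ (Ordinal m_gt0) predT (fun i => A i j0) isT.
  by exists i0 => i; apply: h.
(* A value of [pi2] high enough for all column inequalities at the pure strategy [i0]. *)
have [pi0 pi0P] : exists p, forall j, C i0 j + beta 0 j * (s * c) <= p.
  exists (\sum_j `|C i0 j + beta 0 j * (s * c)|) => j.
  apply: le_trans (ler_norm _) _; rewrite (bigD1 j) //= lerDl sumr_ge0 //.
pose z0 : V := (P_point (delta_mx 0 j0) (A i0 j0), Q_point (delta_mx 0 i0) (s * c) pi0).
pose d0 : V := (0, Q_point 0 0 1).
have zE x : z0 + x *: d0 = (P_point (delta_mx 0 j0) (A i0 j0),
    Q_point (delta_mx 0 i0) (s * c) (pi0 + x)).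
  rewrite /z0 /d0; congr pair => /=; first by rewrite scaler0 addr0.
  rewrite addrC.
  have [qx1 ql1 qp1] := Q_pointK (delta_mx 0 i0) (s * c) pi0.
  have [qx2 ql2 qp2] := Q_pointK 0 0 1.
  have [qx3 ql3 qp3] := Q_pointK (delta_mx 0 i0) (s * c) (pi0 + x).
  apply: Q_ext; rewrite ?Q_x_linear ?Q_lambda_scalar ?Q_pi2_scalar.
  - by rewrite qx1 qx2 qx3 scaler0 add0r.
  - by rewrite ql1 ql2 ql3 mulr0 add0r.
  - by rewrite qp1 qp2 qp3 mulr1 addrC.
have d0n : d0 != 0.
  apply/eqP => /(congr1 (fun d => Q_pi2 d.2)) /=.
  have [_ _ ->] := Q_pointK 0 0 1.
  by rewrite /Q_pi2 linear0 mxE => /eqP; rewrite oner_eq0.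
have ray0 x : 0 <= x -> stratum (grad s) (offset c) (vertical i0 j0) (z0 + x *: d0).
  move=> x0; rewrite zE; set z := (_, _).
  have [eP eQ eP1 eQ1 e0] := gapE s c z.
  have [yE pE] := P_pointK (delta_mx 0 j0) (A i0 j0).
  have [xE lE qE] := Q_pointK (delta_mx 0 i0) (s * c) (pi0 + x).
  have rowA i : P_ineq A (lshift n i) z.1 = A i j0 - A i0 j0.
    by rewrite P_ineqL yE pE trmx_delta -colE mxE.
  have yP j : P_ineq A (rshift m j) z.1 = - (j == j0)%:R.
    by rewrite P_ineqR yE mxE eqxx.
  have xQ i : Q_ineq C beta (lshift n i) z.2 = - (i == i0)%:R.
    by rewrite Q_ineqL xE mxE eqxx.
  have colP j : Q_ineq C beta (rshift m j) z.2 =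
      C i0 j + beta 0 j * (s * c) - (pi0 + x).
    by rewrite Q_ineqR xE lE qE -rowE mxE.
  have sum1 l (a0 : 'I_l) : \sum_a (delta_mx 0 a0 : 'rV[R]_l) 0 a = 1.
    rewrite (bigD1 a0) //= big1 ?addr0 => [|a /negPf aa]; first by rewrite mxE !eqxx.
    by rewrite mxE aa andbF.
  have sP : P_sum z.1 = 1 by rewrite /P_sum yE sum1.
  have sQ : Q_sum z.2 = 1 by rewrite /Q_sum xE sum1.
  have gN : slack (grad s) (offset c) None z = 0.
    by rewrite e0 lE mulrA s2 mul1r subrr.
  split=> [[[[] [q|]]|]|[q|[]]].
  - rewrite eP; case: (split_ordP q) => [i ->|j ->].
      by rewrite rowA subr_le0.
    by rewrite yP oppr_le0 ler0n.
  - by rewrite eP1 sP subrr.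
  - rewrite eQ; case: (split_ordP q) => [i ->|j ->].
      by rewrite xQ oppr_le0 ler0n.
    by rewrite colP; have := pi0P j; lra.
  - by rewrite eQ1 sQ subrr.
  - by rewrite gN.
  - rewrite ffunE; case: (split_ordP q) => [i ->|j ->].
      have [->|/negPf ii0] := eqVneq i i0; first by rewrite eP rowA subrr.
      by rewrite eQ xQ ii0 oppr0.
    by have [//|/negPf jj0] := eqVneq j j0; rewrite eP yP jj0 oppr0.
  - by rewrite ffunE eP1 sP subrr.
  - by rewrite ffunE eQ1 sQ subrr.
have [_ [_ [_ [_ _ _ [t [z [d [tt tv dn ray]]]]]]]] :=
  walk_component gen (vertical_selection i0 j0) d0n ray0.
exists c, k, t, z, d; have l0 : Q_lambda d.2 != 0.
  by apply: contraNneq tv => /(vertical_ray (erefl k) max0 tt dn ray) ->.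
have [dt dle] := walk_recession ray.
have sl : 0 < s * Q_lambda d.2.
  rewrite lt_neqAle eq_sym mulf_eq0 negb_or l0 andbT; apply/andP; split.
    by apply: contra_eq_neq s2 => ->; rewrite mul0r eq_sym oner_neq0.
  by have := dle None; rewrite /= mulNr oppr_le0.
(* Since [s * lambda] strictly increases along the ray, the slice constraint cannot stay tight, so
   it is not selected. *)
split=> // q; apply: contraTneq sl => tq.
by have := dt (inl q); rewrite tq /= mulNr => /eqP; rewrite oppr_eq0 => /eqP ->; rewrite ltxx.
Qed.

(** * From rays of N to equilibria on the path *)

Lemma path_unbounded (PP : set V) s B :
  is_the_path R (setN A C beta) PP -> s * s = 1 ->
  exists2 z, PP z & B <= s * Q_lambda z.2.
Proof.
move=> [_ uniq] s2; have [c [k [t [z [d [tt tN dn sl ray]]]]]] := far_ray s2.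
have gen w : polyQ C beta w -> - 1 - 0 * Q_lambda w = 0 ->
    exists e, [/\ forall q, Q_ineq C beta q w = 0 -> Q_ineq C beta q e = 0,
      Q_sum e = 0 & 0 * Q_lambda e != 0].
  by move=> _ /eqP; rewrite mul0r subr0 oppr_eq0 oner_eq0.
(* The selection [t] avoids the slice constraint, so its ray remains one when that constraint is
   replaced by the void one, that is, in N itself. *)
have ray' x : 0 <= x -> stratum (grad 0) (offset (- 1)) t (z + x *: d).
  move=> /ray [zle zt]; split=> [q|u].
    case: q => [q|]; first by have := zle (Some q).
    have [_ _ _ _ ->] := gapE 0 (- 1) (z + x *: d).
    by rewrite mul0r subr0 lerN10.
  have tu : t u != None by case: u => [q|b]; [exact: tN|rewrite (selection_inr _ tt)].
  by have := zt u; case: (t u) tu.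
have [K [f [g [hom KE Kray _]]]] := walk_component gen tt dn ray'.
(* The component through the ray is homeomorphic to the line, so uniqueness of the path identifies
   it with [PP]. *)
have <- : K = PP.
  apply: uniq; split; last by exists f, g.
  exists z; last by rewrite (setN_complementary k).
  have := ray 0 (lexx 0); rewrite scale0r addr0; exact: (stratum_setN tt).
pose x := `|B - s * Q_lambda z.2| / (s * Q_lambda d.2).
exists (z + x *: d); first by apply: Kray; rewrite divr_ge0 // ltW.
have -> : (z + x *: d).2 = x *: d.2 + z.2 by rewrite addrC.
rewrite Q_lambda_scalar mulrDr mulrCA divfK ?gt_eqF //.
by have := ler_norm (B - s * Q_lambda z.2); lra.
Qed.

(** When [lambda] equals the product of [alpha] and [x], the columns of Q' compare the payoffs of
    [C + alpha^T *m beta] with [pi2]. Full labelling means that only best replies are played, so the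
    payoffs are [pi1] and [pi2], the upper bounds for all deviations. *)
Lemma setN_nash (alpha : 'rV[R]_m) z : setN A C beta z ->
  Q_lambda z.2 = \sum_i alpha 0 i * Q_x z.2 0 i ->
  nash A (C + alpha^T *m beta) (Q_x z.2) (P_y z.1).
Proof.
move=> [[zP y1] [zQ x1] /setP lab] lE.
have x_ge i : 0 <= Q_x z.2 0 i.
  by have := zQ (lshift n i); rewrite Q_ineqL oppr_le0.
have y_ge j : 0 <= P_y z.1 0 j.
  by have := zP (rshift m j); rewrite P_ineqR oppr_le0.
pose r i := (A *m (P_y z.1)^T) i 0.
pose w j := (Q_x z.2 *m (C + alpha^T *m beta)) 0 j.
have r_le i : r i <= P_pi1 z.1.
  by have := zP (lshift n i); rewrite P_ineqL subr_le0.
have wE j : w j - Q_pi2 z.2 = Q_ineq C beta (rshift m j) z.2.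
  rewrite Q_ineqR /w mulmxDr mxE mulmxA; congr (_ + _ - _).
  rewrite [(_ *m beta) 0 j]mxE big_ord1 mulrC; congr (_ * _).
  by rewrite mxE lE; apply: eq_bigr => i _; rewrite [alpha^T i _]mxE mulrC.
have w_le j : w j <= Q_pi2 z.2 by rewrite -subr_le0 wE.
have payA x : payoff A x (P_y z.1) = \sum_i x 0 i * r i.
  by rewrite /payoff -mulmxA mxE.
have payB y : payoff (C + alpha^T *m beta) (Q_x z.2) y = \sum_j w j * y 0 j.
  by rewrite /payoff mxE; apply: eq_bigr => j _; rewrite [y^T j 0]mxE.
have eqA : payoff A (Q_x z.2) (P_y z.1) = P_pi1 z.1.
  rewrite payA -[RHS]mul1r -x1 mulr_suml; apply: eq_bigr => i _.
  have := lab (lshift n i); rewrite !inE P_ineqL Q_ineqL subr_eq0 oppr_eq0.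
  by case/orP => /eqP; rewrite /r => ->; rewrite ?mul0r.
have eqB : payoff (C + alpha^T *m beta) (Q_x z.2) (P_y z.1) = Q_pi2 z.2.
  rewrite payB -[RHS]mulr1 -y1 mulr_sumr; apply: eq_bigr => j _.
  have := lab (rshift m j); rewrite !inE P_ineqR -wE subr_eq0 oppr_eq0.
  by case/orP => /eqP ->; rewrite ?mulr0.
split=> // [x' [x'_ge x'1]|y' [y'_ge y'1]].
  rewrite eqA payA -[leRHS]mul1r -x'1 mulr_suml; apply: ler_sum => i _.
  exact: ler_wpM2l.
rewrite eqB payB -[leRHS]mulr1 -y'1 mulr_sumr; apply: ler_sum => j _.
exact: ler_wpM2r.
Qed.

End BestResponse.

Theorem lemma8 (R : realType) (m n : nat) (A C : 'M[R]_(m, n)) (beta : 'rV[R]_n)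
    (hA : A != 0) (hC : C != 0) (hbeta : beta != 0)
    (hP : nondegenerate_P A) (hQ : nondegenerate_Q C beta)
    (PP : set ('rV[R]_(n + 1) * 'rV[R]_(m + 2)))
    (hPP : is_the_path R (setN A C beta) PP) :
  forall alpha : 'rV[R]_m,
    exists (v : 'rV[R]_(n + 1)) (w : 'rV[R]_(m + 2)),
      [/\ PP (v, w), Q_lambda w = \sum_i alpha 0 i * Q_x w 0 i
        & nash A (C + alpha^T *m beta) (Q_x w) (P_y v)].
Proof.
move=> alpha.
have m_gt0 : (0 < m)%N.
  rewrite lt0n; apply: contraNneq hA => m0; apply/eqP/matrixP => i.
  by have := ltn_ord i; rewrite {2}m0.
have [[[z0 _ PPE] _] _] := hPP.
have PPN : PP `<=` setN A C beta by rewrite PPE; exact: connected_component_sub.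
have PPc : connected PP by rewrite PPE; exact: component_connected.
pose psi (w : 'rV[R]_(m + 2)) := Q_lambda w - \sum_i alpha 0 i * Q_x w 0 i.
pose phi (z : 'rV[R]_(n + 1) * 'rV[R]_(m + 2)) := psi z.2.
have phi_cont : continuous phi.
  have psi_scalar : scalar psi.
    move=> t v w; rewrite /psi Q_lambda_scalar Q_x_linear.
    rewrite mulrBr addrACA -opprD mulr_sumr -big_split /=; congr (_ - _).
    by apply: eq_bigr => i _; rewrite mxE [X in _ * (X + _)]mxE; ring.
  move=> z; apply: (@continuous_comp _ _ _ snd psi); first exact: cvg_snd.
  exact: scalar_continuous.
(* On the simplex each [x_i] is at most 1, so [B] bounds the product of [alpha] and [x]. *)
pose B := \sum_i `|alpha 0 i|.
have bound z : PP z -> `|\sum_i alpha 0 i * Q_x z.2 0 i| <= B.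
  move=> /PPN [_ [zQ x1] _].
  have x_ge i : 0 <= Q_x z.2 0 i.
    by have := zQ (lshift n i); rewrite Q_ineqL oppr_le0.
  apply: le_trans (ler_norm_sum _ _ _) _; apply: ler_sum => i _.
  rewrite normrM -[leRHS]mulr1 ler_wpM2l // ger0_norm // -x1 (bigD1 i) //=.
  by rewrite lerDl sumr_ge0.
have [zp PPp Bp] := path_unbounded m_gt0 hP hQ B hPP (mulr1 1).
have [zm PPm Bm] := path_unbounded m_gt0 hP hQ B hPP (etrans (mulrNN 1 1) (mulr1 1)).
(* Intermediate values: [phi] is non-positive at [zm], where [lambda <= - B], and non-negative at
   [zp], where [lambda >= B]. *)
have /connected_intervalP itv : connected (phi @` PP).
  exact: (connected_continuous_connected PPc (continuous_subspaceT phi_cont)).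
have [z PPz phiz] : (phi @` PP) 0.
  apply: (itv (phi zm) (phi zp)); [by exists zm|by exists zp|].
  have := bound _ PPp; have := bound _ PPm; rewrite !ler_norml /phi /psi.
  by move=> /andP[? ?] /andP[? ?]; apply/andP; split; lra.
have zE : Q_lambda z.2 = \sum_i alpha 0 i * Q_x z.2 0 i.
  by move/eqP: phiz; rewrite /phi /psi subr_eq0 => /eqP.
by exists z.1, z.2; split=> //; [case: z PPz {phiz zE}|apply: setN_nash => //; apply: PPN].
Qed.
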